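(* Consider the spatially periodic KP-I equation $$(u_t+u_{xxx}+\partial_x(f(u)))_x-u_{yy}=0,\qquad f(u)=\tfrac{u^2}{2},$$ for $(t,x,y)\in(0,\infty)\times[0,K_1]\times[0,K_2]$, with $u$ being $K_1$-periodic in $x$ and $K_2$-periodic in $y$. Let $c,\varphi_0,\varphi_1,\xi\in\mathbb{R}$ satisfy $\varphi_0<\varphi_1$ and $3c<2\varphi_0+\varphi_1$, and put $$\kappa^2=\frac{\varphi_1-\varphi_0}{\varphi_0+2\varphi_1-3c}\in(0,1),\qquad \alpha=\sqrt{\frac{\varphi_0+2\varphi_1-3c}{12}},\qquad T=\frac{2K(\kappa)}{\alpha},\qquad K_1=T .$$ The equation supports the cnoidal traveling wave solutions $u(t,x,y)=\varphi(x-ct)$ with $$\varphi(s)=\varphi_0+(\varphi_1-\varphi_0)\,\mathrm{cn}^2(\alpha(s-\xi);\kappa).$$ For every such wave (that is, for all values of the parameters $\kappa\in(0,1)$ and $T=2K(\kappa)/\alpha$) there exists a period $K_2>0$, depending on the particular wave, such that the wave is spectrally unstable and linearly unstable with respect to perturbations that are $T$-periodic in $x$ and $K_2$-periodic in $y$.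
   Context: $\mathrm{cn}(\cdot;\kappa)$ is the Jacobi elliptic function of modulus $\kappa$, and $K(\kappa)$ is the complete elliptic integral of the first kind, $K(\kappa)=\int_0^1\frac{dz}{\sqrt{(1-z^2)(1-\kappa^2z^2)}}$. Linearized problem. Substituting $u(t,x,y)=\varphi(x-ct)+v(t,x-ct,y)$ and dropping terms nonlinear in $v$, one gets, for $v$ with $\int_0^{K_1}v(t,x,y)\,dx=0$, the evolution equation $v_t=\mathcal{A}v$ with $$\mathcal{A}v=\partial_x\big(-\partial_x^2+c-f'(\varphi)\big)v+\partial_x^{-1}\partial_{yy}v,\qquad f'(\varphi)=\varphi .$$ Here $\mathcal{A}$ acts on the space $X$ of complex-valued functions $v\in L^2$ that are $K_1$-periodic in $x$, $K_2$-periodic in $y$, and satisfy $\int_0^{K_1}v(x,y)\,dx=0$ for a.e. $y$, with domain $\{v\in X:\mathcal{A}v\in X\}$ ($\mathcal{A}v$ understood in the sense of periodic distributions); $\partial_x^{-1}$ denotes the mean-zero (in $x$) periodic antiderivative in $x$. $\mathcal{A}$ generates a $C_0$ semigroup $e^{t\mathcal{A}}$ on $X$. The wave is spectrally stable if $\sigma(\mathcal{A})\subset\{\lambda\in\mathbb{C}:\mathrm{Re}\,\lambda\le 0\}$, and spectrally unstable otherwise. It is linearly stable if the growth bound of the semigroup $e^{t\mathcal{A}}$ is non-positive (equivalently, every solution of $v_t=\mathcal{A}v$ with $v(0)\in X$ satisfies $\lim_{t\to\infty}e^{-\delta t}\|v(t,\cdot)\|=0$ for every $\delta>0$), and linearly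 unstable otherwise. *)

(* Defs.v *)
From mathcomp Require Import all_boot all_order all_algebra.
From mathcomp Require Import all_classical all_reals all_analysis.
From mathcomp Require Import complex.

Set Implicit Arguments.
Unset Strict Implicit.
Unset Printing Implicit Defensive.

Import Order.TTheory GRing.Theory Num.Theory.
Import numFieldNormedType.Exports.

Local Open Scope classical_set_scope.
Local Open Scope ring_scope.
Local Open Scope complex_scope.

Section elliptic.
Context {R : realType}.
Implicit Types k u th z : R.

Local Notation leb := (@lebesgue_measure R).

Definition ellipticK k : R :=
  \int[leb]_(z in `[0, 1]) (Num.sqrt ((1 - z ^+ 2) * (1 - k ^+ 2 * z ^+ 2)))^-1.

(* The integral from 0 to th is oriented: it is negative for th < 0. *)
Definition ellipticF k th : R :=
  let g := fun t : R => (Num.sqrt (1 - k ^+ 2 * sin t ^+ 2))^-1 in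
  if 0 <= th then \int[leb]_(t in `[0, th]) g t
  else - \int[leb]_(t in `[th, 0]) g t.

(* For 0 <= k < 1, ellipticF k is an increasing bijection of the real line, so
   that the amplitude, its inverse, does not depend on the default value 0. *)
Definition jacobi_am k u : R := xget 0 [set th | ellipticF k th = u].

Definition jacobi_cn k u : R := cos (jacobi_am k u).

Definition cnoidal_modulus (c phi0 phi1 : R) : R :=
  Num.sqrt ((phi1 - phi0) / (phi0 + 2 * phi1 - 3 * c)).

Definition cnoidal_alpha (c phi0 phi1 : R) : R :=
  Num.sqrt ((phi0 + 2 * phi1 - 3 * c) / 12).

Definition cnoidal_period (c phi0 phi1 : R) : R :=
  2 * ellipticK (cnoidal_modulus c phi0 phi1) / cnoidal_alpha c phi0 phi1.

Definition cnoidal (c phi0 phi1 xi : R) (s : R) : R :=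
  phi0 + (phi1 - phi0) *
    jacobi_cn (cnoidal_modulus c phi0 phi1)
      (cnoidal_alpha c phi0 phi1 * (s - xi)) ^+ 2.

End elliptic.

Section kp1_equation.
Context {R : realType}.
Implicit Types u : R -> R -> R -> R.

Definition kp1_flux (r : R) : R := r ^+ 2 / 2.

Definition ddt u : R -> R -> R -> R := fun t x y => derive1 (fun s => u s x y) t.
Definition ddx u : R -> R -> R -> R := fun t x y => derive1 (fun s => u t s y) x.
Definition ddy u : R -> R -> R -> R := fun t x y => derive1 (fun s => u t x s) y.

Definition kp1_inner u : R -> R -> R -> R := fun t x y =>
  ddt u t x y + ddx (ddx (ddx u)) t x y
  + ddx (fun t' x' y' => kp1_flux (u t' x' y')) t x y.

(* The library derivative is a total function, so the existence of every
   derivative occurring in the equation is required separately. *)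
Definition kp1_solution (K1 K2 : R) u : Prop :=
  forall t x y, 0 < t ->
  [/\ u t (x + K1) y = u t x y /\ u t x (y + K2) = u t x y,
      derivable (fun s => u s x y) t 1,
      [/\ derivable (fun s => u t s y) x 1,
          derivable (fun s => ddx u t s y) x 1,
          derivable (fun s => ddx (ddx u) t s y) x 1 &
          derivable (fun s => kp1_inner u t s y) x 1],
      derivable (fun s => u t x s) y 1 /\ derivable (fun s => ddy u t x s) y 1
    & ddx (kp1_inner u) t x y - ddy (ddy u) t x y = 0].

End kp1_equation.

Section complex_integral.
Context d {T : measurableType d} {R : realType}.

Definition cintegral (mu : {measure set T -> \bar R}) (D : set T)
    (f : T -> R[i]) : R[i] :=
  (\int[mu]_(x in D) complex.Re (f x)) +i* (\int[mu]_(x in D) complex.Im (f x)).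

End complex_integral.

(* Elements of L^2 are represented by everywhere defined functions on the plane,
   doubly periodic at every point, and equality in L^2 is equality almost
   everywhere (eqX). *)
Section state_space.
Context {R : realType}.
Variables K1 K2 : R.
Implicit Types (p : R * R) (v w : R * R -> R[i]).

Local Notation leb := (@lebesgue_measure R).

Local Notation leb2 := (leb \x leb)%E.

Definition cell : set (measurableTypeR R * measurableTypeR R) :=
  [set p | 0 <= p.1 <= K1 /\ 0 <= p.2 <= K2].

Definition sqmod (z : R[i]) : R := complex.Re z ^+ 2 + complex.Im z ^+ 2.

Definition biperiodic (V : Type) (g : R * R -> V) : Prop :=
  forall x y, g (x + K1, y) = g (x, y) /\ g (x, y + K2) = g (x, y).

Definition inX v : Prop :=
  [/\ biperiodic v,
      measurable_fun [set: measurableTypeR R * measurableTypeR R]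
        (fun p => complex.Re (v p) : measurableTypeR R)
      /\ measurable_fun [set: measurableTypeR R * measurableTypeR R]
        (fun p => complex.Im (v p) : measurableTypeR R),
      (\int[leb2]_(p in cell) (sqmod (v p))%:E < +oo)%E
    & {ae leb, forall y : R, cintegral leb `[0, K1] (fun x => v (x, y)) = 0}].

Definition eqX v w : Prop := {ae leb2, forall p, v p = w p}.

Definition normX v : R := Num.sqrt (\int[leb2]_(p in cell) sqmod (v p)).

End state_space.

(* A periodic distribution is given by its values on real test functions; its
   values on complex ones follow by complex linearity. *)
Section distributions.
Context {R : realType}.
Variables K1 K2 : R.
Implicit Types (p : R * R) (g psi : R * R -> R) (T q : (R * R -> R) -> R[i]).
Implicit Types v w : R * R -> R[i].

Definition pdx g : R * R -> R := fun p => derive1 (fun s : R => g (s, p.2)) p.1.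
Definition pdy g : R * R -> R := fun p => derive1 (fun s : R => g (p.1, s)) p.2.

Fixpoint partials (s : seq bool) g : R * R -> R :=
  if s is b :: s' then (if b then pdy else pdx) (partials s' g) else g.

Definition smooth g : Prop := forall s : seq bool,
  continuous (partials s g : R * R -> R) /\
  forall p, derivable (fun r : R => partials s g (r, p.2)) p.1 1
         /\ derivable (fun r : R => partials s g (p.1, r)) p.2 1.

Definition test_function psi : Prop := smooth psi /\ biperiodic K1 K2 psi.

Definition periodic_distribution T : Prop :=
  (forall (a : R) psi1 psi2, test_function psi1 -> test_function psi2 ->
     T (fun p => a * psi1 p + psi2 p) = a%:C * T psi1 + T psi2)
  /\ exists (N : nat) (C : R), forall psi (M : R), test_function psi ->
       (forall s p, (size s <= N)%N -> `|partials s psi p| <= M) ->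
       Num.sqrt (sqmod (T psi)) <= C * M.

Definition eq_dist T1 T2 : Prop :=
  forall psi, test_function psi -> T1 psi = T2 psi.

Definition distr v : (R * R -> R) -> R[i] :=
  fun psi => cintegral (@lebesgue_measure R \x @lebesgue_measure R)%E (cell K1 K2) (fun p => v p * (psi p)%:C).

Definition dist_dx T : (R * R -> R) -> R[i] := fun psi => - T (pdx psi).
Definition dist_dy T : (R * R -> R) -> R[i] := fun psi => - T (pdy psi).

Definition dist_mean_zero_x T : Prop :=
  forall psi, test_function psi -> (forall x y, psi (x, y) = psi (0, y)) ->
  T psi = 0.

Definition is_dist_dxinv T q : Prop :=
  [/\ periodic_distribution q, eq_dist (dist_dx q) T & dist_mean_zero_x q].

(* The graph of the linearized operator: v is in its domain and is mapped to w.
   For the flux r ^+ 2 / 2 the coefficient f'(phi) is phi. *)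
Definition linKP (c : R) (phi : R -> R) v w : Prop :=
  [/\ inX K1 K2 v, inX K1 K2 w
    & exists2 q, is_dist_dxinv (dist_dy (dist_dy (distr v))) q
      & eq_dist (distr w)
          (fun psi =>
             dist_dx (fun chi =>
                - dist_dx (dist_dx (distr v)) chi
                + distr (fun p => (c - phi p.1)%:C * v p) chi) psi
             + q psi)].

End distributions.

(* An operator on X is given by its graph, a relation between representatives
   invariant under almost everywhere equality. *)
Section stability.
Context {R : realType}.
Variables (K1 K2 : R).
Implicit Types (s t : R).
Implicit Types (v w : R * R -> R[i]) (A : (R * R -> R[i]) -> (R * R -> R[i]) -> Prop).
Implicit Types (S : R -> (R * R -> R[i]) -> R * R -> R[i]).

Local Notation leb := (@lebesgue_measure R).
Local Notation X := (inX K1 K2).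
Local Notation "`N v" := (normX K1 K2 v) (at level 10, v at level 8).

(* Boundedness of the inverse includes injectivity. *)
Definition in_resolvent_set A (lambda : R[i]) : Prop :=
  (forall g, X g ->
     exists v w, A v w /\ eqX (fun p => lambda * v p - w p) g)
  /\ exists C : R, forall v w, A v w ->
       `N v <= C * `N (fun p => lambda * v p - w p).

Definition spectrum A : set R[i] := [set lambda | ~ in_resolvent_set A lambda].

Definition spectrally_stable A : Prop :=
  spectrum A `<=` [set lambda | complex.Re lambda <= 0].

Definition spectrally_unstable A : Prop := ~ spectrally_stable A.

Definition C0_semigroup S : Prop :=
  [/\ (forall t v, 0 <= t -> X v -> X (S t v)),
      (forall t (a : R[i]) v w, 0 <= t -> X v -> X w ->
         eqX (S t (fun p => a * v p + w p)) (fun p => a * S t v p + S t w p))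
      /\ (forall t, 0 <= t -> exists C : R, forall v, X v -> `N (S t v) <= C * `N v),
      (forall v, X v -> eqX (S 0 v) v),
      (forall s t v, 0 <= s -> 0 <= t -> X v -> eqX (S (s + t) v) (S s (S t v)))
    & (forall v, X v -> `N (fun p => S t v p - v p) @[t --> 0^'+] --> (0 : R))].

Definition generates A S : Prop := forall v w, X v -> X w ->
  (A v w <->
   `N (fun p => (t^-1)%:C * (S t v p - v p) - w p) @[t --> 0^'+] --> (0 : R)).

Definition growth_bound S : \bar R :=
  ereal_inf [set w%:E | w in [set w : R | exists M : R, forall t v,
    0 <= t -> X v -> `N (S t v) <= M * expR (w * t) * `N v]].

(* Mild solutions on the half-line, that is the orbits of the semigroup; u is
   the integral of v from 0 to t. *)
Definition mild_solution A (v : R -> R * R -> R[i]) : Prop :=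
  [/\ (forall t, 0 <= t -> X (v t)),
      (forall t, 0 <= t ->
         `N (fun p => v s p - v t p) @[s --> within `[0, +oo[ (nbhs t)] --> (0 : R))
    & (forall t, 0 <= t -> exists2 u,
         (forall psi, test_function K1 K2 psi ->
            distr K1 K2 u psi =
            cintegral leb `[0, t] (fun s => distr K1 K2 (v s) psi))
         & A u (fun p => v t p - v 0 p))].

Definition solutions_subexponential A : Prop :=
  forall v : R -> R * R -> R[i], mild_solution A v -> forall delta : R, 0 < delta ->
  expR (- delta * t) * `N (v t) @[t --> +oo] --> (0 : R).

(* Linear stability can be read on the growth bound of the semigroup or on the
   solutions; instability is required in both senses. The second sense does
   not refer to the existence of the semigroup. *)
Definition linearly_unstable A : Prop :=
  (forall S, C0_semigroup S -> generates A S -> ~ (growth_bound S <= 0)%E)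
  /\ ~ solutions_subexponential A.

End stability.

(* Main.v *)
Require Import Defs.
From mathcomp Require Import all_boot all_order all_algebra.
From mathcomp Require Import all_classical all_reals all_analysis.
From mathcomp Require Import complex measurable_realfun ring lra.

(** The linearization of KP-I about a cnoidal wave has explicit eigenfunctions,
    and the instability is read off one of them.

    Put L = - d^2/dx^2 + c - phi. A function v = z'(x) cos(kk y) is an
    eigenfunction of the linearized operator, with eigenvalue lam, as soon as
    (L z')' = kk^2 z + lam z' ([growing_mode]). In the variable
    u = alpha (x - xi) the coefficient c - phi is alpha^2 times
    12 kappa^2 sn^2 u - 4 - 4 kappa^2, that is, six times the potential of
    Lame's equation psi'' = (2 kappa^2 sn^2 u - E) psi up to a constant. As in
    the squared eigenfunction relations of the Lax pair of KP-I, the product z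
    of two solutions of Lame's equation satisfies the equation of the mode,
    with kk proportional to the difference of the two energies E and lam to the
    sum of the eigenvalues of the factors for the third order operator that
    commutes with Lame's ([lame_product_equation]).

    It remains to make the product periodic and lam positive. For E in the gap
    between 1 and 1 + kappa^2 the Floquet solutions are real and explicit
    ([lame_sol]): one grows and one decays, with opposite exponents over a
    period. The exponent vanishes at both ends of the gap, so it takes some
    values twice ([paired_exponents]), and the product of the growing solution
    for one energy and the decaying solution for the other is periodic. The
    exponent is the product of the eigenvalue of the commuting operator and of
    an integral that is strictly monotone in the energy. Hence the eigenvalues
    of the two factors differ when the exponents agree, and lam is not 0
    ([paired_parameters]).

    The period K2 = 2 pi / kk then makes the mode an element of the domain:
    integrated against a test function, both equations to be verified are
    integrals of total derivatives over a period cell ([mode_linKP]). The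
    eigenvalue lam contradicts spectral stability, and exp(lam t) times the
    mode is a mild solution that grows. A semigroup generated by the operator
    follows this solution: it does so to first order at time 0, and the errors
    of many small time steps add up to an arbitrarily small total as soon as
    some exponential bound on the semigroup is available
    ([semigroup_growth_contradiction]). *)

Set Implicit Arguments.
Unset Strict Implicit.
Unset Printing Implicit Defensive.

Import Order.TTheory GRing.Theory Num.Theory.
Import numFieldNormedType.Exports.

Local Open Scope classical_set_scope.
Local Open Scope ring_scope.

(** * Calculus on the real line *)

Section calculus.
Context {R : realType}.
Implicit Types (f g : R -> R) (x y a b : R).
Local Notation mu := (@lebesgue_measure R).

Lemma derD f g x a b : is_derive x 1 f a -> is_derive x 1 g b ->
  is_derive x 1 (fun t => f t + g t) (a + b).
Proof. by move=> fa gb; exact: is_deriveD. Qed.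

Lemma derN f x a : is_derive x 1 f a -> is_derive x 1 (fun t => - f t) (- a).
Proof. by move=> fa; exact: is_deriveN. Qed.

Lemma derM f g x a b : is_derive x 1 f a -> is_derive x 1 g b ->
  is_derive x 1 (fun t => f t * g t) (a * g x + f x * b).
Proof.
move=> fa gb; rewrite addrC [X in _ + X]mulrC.
exact: is_deriveM.
Qed.

Lemma derX f x a n : is_derive x 1 f a ->
  is_derive x 1 (fun t => f t ^+ n.+1) (n.+1%:R * f x ^+ n * a).
Proof.
move=> fa; have -> : (fun t => f t ^+ n.+1) = f ^+ n.+1.
  by apply/funext => t; rewrite exprfctE.
exact: is_deriveX.
Qed.

Lemma der_cst c x : is_derive x 1 (fun=> c : R) 0.
Proof. exact: is_derive_cst. Qed.

Lemma der_id x : is_derive x 1 (fun t : R => t) 1.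
Proof. exact: is_derive_id. Qed.

Lemma der_comp f g x a b : is_derive (g x) 1 f a -> is_derive x 1 g b ->
  is_derive x 1 (fun t => f (g t)) (a * b).
Proof. by move=> fa gb; exact: is_derive1_comp. Qed.

Lemma derV f x a : f x != 0 -> is_derive x 1 f a ->
  is_derive x 1 (fun t => (f t)^-1) (- (f x) ^- 2 * a).
Proof. by move=> fx fa; exact: is_deriveV. Qed.

Lemma der_sqrt f x a : 0 < f x -> is_derive x 1 f a ->
  is_derive x 1 (fun t => Num.sqrt (f t)) ((2 * Num.sqrt (f x))^-1 * a).
Proof.
by move=> fx fa; apply: der_comp; exact: is_derive1_sqrt.
Qed.

Lemma der_derive1 f x a : is_derive x 1 f a -> derive1 f x = a.
Proof. by move=> fa; rewrite derive1E derive_val. Qed.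

Lemma der_continuous f f' : (forall x, is_derive x 1 f (f' x)) -> continuous f.
Proof.
move=> df x; apply/differentiable_continuous/derivable1_diffP.
by case: (df x).
Qed.

Lemma der_MVT f f' a b : (forall x, is_derive x 1 f (f' x)) -> a <= b ->
  exists2 c, a <= c <= b & f b - f a = f' c * (b - a).
Proof.
move=> df ab; have cf : {within `[a, b], continuous f}.
  by apply: continuous_subspaceT; exact: (der_continuous df).
have [c] := MVT_segment ab (fun x _ => df x) cf.
by rewrite in_itv/= => cab E; exists c.
Qed.

Lemma der_ndecr f f' : (forall x, is_derive x 1 f (f' x)) ->
  (forall x, 0 <= f' x) -> {homo f : x y / x <= y}.
Proof.
move=> df f0 x y xy; rewrite -subr_ge0.
by have [c _ ->] := der_MVT df xy; rewrite mulr_ge0// subr_ge0.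
Qed.

Lemma der_eq f g f' : (forall x, is_derive x 1 f (f' x)) ->
  (forall x, is_derive x 1 g (f' x)) -> forall x, f x = f 0 + (g x - g 0).
Proof.
move=> df dg x; have D y : is_derive y 1 (fun t => f t - g t) 0.
  by rewrite -(subrr (f' y)); exact: (derD (df y) (derN (dg y))).
have := is_derive_0_is_cst x 0 D; lra.
Qed.

(** Equality at the end points would make the monotone function [f] constant
    in between, against the positive derivative. *)
Lemma der_ndecr_lt f f' a b x0 : (forall x, is_derive x 1 f (f' x)) ->
  (forall x, 0 <= f' x) -> a < x0 < b -> 0 < f' x0 -> f a < f b.
Proof.
move=> df f0 /andP[ax xb] fx0.
have nd := der_ndecr df f0.
rewrite lt_neqAle nd ?andbT; last by rewrite ltW// (lt_trans ax).
apply/eqP => fab; move: fx0; rewrite (_ : f' x0 = 0) ?ltxx//.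
suff : is_derive x0 1 f 0.
  by move=> D; rewrite -(der_derive1 (df x0)) (der_derive1 D).
apply: (@near_eq_is_derive _ _ _ (cst (f a))).
  rewrite /=; near=> t.
  have at_ : a < t by near: t; exact: lt_nbhsr.
  have tb : t < b by near: t; exact: lt_nbhsl.
  by apply/eqP; rewrite eq_le nd ?(ltW at_)// fab nd// ltW.
Unshelve. all: by end_near. Qed.

Lemma integrable_itv f a b : continuous f -> mu.-integrable `[a, b] (EFin \o f).
Proof.
move=> cf; apply: continuous_compact_integrable; first exact: segment_compact.
exact: continuous_subspaceT.
Qed.

Lemma FTC f f' a b : (forall x, is_derive x 1 f (f' x)) -> continuous f' ->
  a <= b -> \int[mu]_(x in `[a, b]) f' x = f b - f a.
Proof.
move=> df cf; rewrite le_eqVlt => /predU1P[->|ab].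
  by rewrite set_itv1 Rintegral_set1 subrr.
have cf0 := der_continuous df.
rewrite /Rintegral (@continuous_FTC2 R f' f)//.
- exact: continuous_subspaceT.
- split; first by move=> x _; case: (df x).
  + by apply: cvg_at_right_filter; exact: cf0.
  + by apply: cvg_at_left_filter; exact: cf0.
- by move=> x _; exact: der_derive1.
Qed.

(** The oriented integral from 0, in the shape of [ellipticF]. *)
Definition prim f x : R :=
  if 0 <= x then \int[mu]_(t in `[0, x]) f t else - \int[mu]_(t in `[x, 0]) f t.

Lemma is_derive_prim f x : continuous f -> is_derive x 1 (prim f) (f x).
Proof.
move=> cf; pose a : R := - `|x| - 1; pose u : R := `|x| + 1.
pose F (t : R) : R := \int[mu]_(s in `[a, t]) f s.
have ax : a < x by have := ler_norm (- x); rewrite normrN /a; lra.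
have xu : x < u by have := ler_norm x; rewrite /u; lra.
have a0 : a < 0 by have := normr_ge0 x; rewrite /a; lra.
have itf b c : mu.-integrable `[b, c] (EFin \o f) by exact: integrable_itv.
have B b c d : b <= c -> c <= d ->
    \int[mu]_(s in `[b, d]) f s - \int[mu]_(s in `[b, c]) f s
    = \int[mu]_(s in `[c, d]) f s.
  move=> bc cd; rewrite Rintegral_itvB ?bnd_simp//.
  rewrite Rintegral_itv_obnd_cbnd//.
  by apply: integrableS (itf c d) => //; apply: subset_itvr; rewrite bnd_simp.
have [dF F'] : derivable F x 1 /\ derive1 F x = f x.
  by apply: (@continuous_FTC1_closed _ f a x u) => //; exact: cf.
have DF : is_derive x 1 F (f x) by apply: DeriveDef dF _; rewrite -derive1E.
apply: (@near_eq_is_derive _ _ _ (fun t => F t - F 0)).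
- near=> t; have at' : a < t by near: t; exact: lt_nbhsr.
  rewrite /prim /F; case: leP => t0; last rewrite -opprB; rewrite B//; exact: ltW.
- by have := derD DF (derN (der_cst (F 0) x)); rewrite oppr0 addr0.
Unshelve. all: by end_near. Qed.

Lemma prim0 f : prim f 0 = 0.
Proof. by rewrite /prim lexx set_itv1 Rintegral_set1. Qed.

Lemma prim_periodic f T x : continuous f -> (forall x, f (x + T) = f x) ->
  prim f (x + T) = prim f x + prim f T.
Proof.
move=> cf fT.
have D y : is_derive y 1 (fun t => prim f (t + T)) (f y).
  rewrite -fT -[f _]mulr1; apply: (der_comp (is_derive_prim _ cf)).
  by have := derD (der_id y) (der_cst T y); rewrite addr0.
have := der_eq D (fun y => is_derive_prim y cf) x.
by rewrite prim0 add0r subr0 => ->; rewrite addrC.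
Qed.

(** The window of one period around the point where [f] is positive suffices,
    as every period carries the same integral. *)
Lemma prim_gt0 f T x0 : continuous f -> (forall x, f (x + T) = f x) ->
  0 < T -> (forall x, 0 <= f x) -> 0 < f x0 -> 0 < prim f T.
Proof.
move=> cf fT T0 f0 fx0.
have := @der_ndecr_lt (prim f) f (x0 - T / 2) (x0 - T / 2 + T) x0
  (fun y => is_derive_prim y cf) f0.
rewrite (prim_periodic (x0 - T / 2) cf fT) ltrDl; apply => //.
by apply/andP; split; lra.
Qed.

Lemma primB f g x : continuous f -> continuous g ->
  prim (fun t => f t - g t) x = prim f x - prim g x.
Proof.
move=> cf cg.
have cfg : continuous (fun t => f t - g t).
  by move=> t; apply: continuousB; [exact: cf|exact: cg].
have D y := derD (is_derive_prim y cf) (derN (is_derive_prim y cg)).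
have := der_eq D (fun y => is_derive_prim y cfg) x.
by rewrite !prim0 subr0 add0r => ->; rewrite subr0.
Qed.

Lemma der_periodic f f' T : (forall x, is_derive x 1 f (f' x)) ->
  (forall x, f (x + T) = f x) -> forall x, f' (x + T) = f' x.
Proof.
move=> df fT x.
have := @der_comp f (fun y => y + T) x _ _ (df (x + T))
  (derD (der_id x) (der_cst T x)).
rewrite addr0 mulr1 => D; rewrite -(der_derive1 (df x)) -(der_derive1 D).
by congr (derive1 _ x); apply/funext => y.
Qed.

End calculus.

(** * The amplitude and the complete elliptic integral *)

Section elliptic_functions.
Context {R : realType}.
Variable k : R.
Hypothesis k1 : k ^+ 2 < 1.
Implicit Types t u x y : R.
Local Notation mu := (@lebesgue_measure R).

Let delta t : R := Num.sqrt (1 - k ^+ 2 * sin t ^+ 2).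
Let g t : R := (delta t)^-1.

Lemma delta2_gt0 s : s ^+ 2 <= 1 -> 0 < 1 - k ^+ 2 * s ^+ 2.
Proof.
move=> s1; rewrite subr_gt0 (le_lt_trans _ k1)//.
by rewrite ler_piMr// sqr_ge0.
Qed.

Lemma sin2_le1 t : sin t ^+ 2 <= 1.
Proof. by have := cos2Dsin2 t; have := sqr_ge0 (cos t); lra. Qed.

Let delta_gt0 t : 0 < delta t.
Proof. by rewrite sqrtr_gt0 delta2_gt0// sin2_le1. Qed.

Let g_gt0 t : 0 < g t.
Proof. by rewrite invr_gt0. Qed.

Let g_ge1 t : 1 <= g t.
Proof.
rewrite -[leLHS]invr1 lef_pV2 ?posrE//.
rewrite -[leRHS]sqrtr1 ler_sqrt// gerBl mulr_ge0 ?sqr_ge0//.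
Qed.

Lemma is_derive_delta t :
  is_derive t 1 (fun s => Num.sqrt (1 - k ^+ 2 * sin s ^+ 2))
    (- (k ^+ 2 * sin t * cos t) / Num.sqrt (1 - k ^+ 2 * sin t ^+ 2)).
Proof.
have d := derD (der_cst 1 t) (derN (derM (der_cst (k ^+ 2) t)
  (derX 1 (is_derive_sin t)))).
have d' := @der_sqrt R (fun s => 1 - k ^+ 2 * sin s ^+ 2) t _
  (delta2_gt0 (sin2_le1 t)) d.
apply: (is_derive_eq d').
rewrite -/(delta t); field.
by rewrite gt_eqF.
Qed.

Let continuous_g : continuous g.
Proof.
by apply: der_continuous => t; apply: derV; [rewrite gt_eqF|exact: is_derive_delta].
Qed.

Let F := ellipticF k.

Let is_derive_F t : is_derive t 1 F (g t).
Proof. exact: (is_derive_prim t continuous_g). Qed.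

Let F0 : F 0 = 0.
Proof. exact: prim0. Qed.

Let ltr_F : {homo F : x y / x < y}.
Proof.
move=> x y xy; apply: (@der_ndecr_lt _ F g x y ((x + y) / 2)).
- exact: is_derive_F.
- by move=> t; exact: ltW.
- by apply/andP; split; lra.
- exact: g_gt0.
Qed.

Let F_inj : injective F.
Proof.
by move=> x y Fxy; case: (ltgtP x y) => // /ltr_F; rewrite Fxy ltxx.
Qed.

(* The speed of F is at least 1, so F leaves every bounded set. *)
Let F_expands x y : x <= y -> y - x <= F y - F x.
Proof.
move=> xy; have [c _ ->] := der_MVT is_derive_F xy.
by rewrite ler_peMl ?g_ge1// subr_ge0.
Qed.

Let F_surj u : exists t, F t = u.
Proof.
pose a := `|u|.
have a0 : 0 <= a by exact: normr_ge0.
have Fa : u <= F a.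
  have := F_expands a0; have := ler_norm u; rewrite F0 /a; lra.
have FNa : F (- a) <= u.
  have := @F_expands (- a) 0; rewrite F0 oppr_le0 => /(_ a0).
  have := ler_norm (- u); rewrite normrN /a; lra.
have aa : - a <= a by lra.
have cF : {within `[- a, a], continuous F}.
  by apply: continuous_subspaceT; exact: der_continuous is_derive_F.
have vF : Num.min (F (- a)) (F a) <= u <= Num.max (F (- a)) (F a).
  by rewrite ge_min FNa le_max Fa orbT.
by have [t _ Ft] := IVT aa cF vF; exists t.
Qed.

Lemma ellipticF_am u : ellipticF k (jacobi_am k u) = u.
Proof. by have /(xgetPex 0) := F_surj u. Qed.

Let am_F t : jacobi_am k (F t) = t.
Proof. by apply: F_inj; exact: ellipticF_am. Qed.

Lemma am0 : jacobi_am k 0 = 0.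
Proof. by rewrite -[X in jacobi_am k X]F0 am_F. Qed.

Lemma is_derive_am u : is_derive u 1 (jacobi_am k)
  (Num.sqrt (1 - k ^+ 2 * sin (jacobi_am k u) ^+ 2)).
Proof.
have := @is_derive_inverse R F (jacobi_am k) (g (jacobi_am k u)) (jacobi_am k u).
have -> : F (jacobi_am k u) = u by exact: ellipticF_am.
rewrite /g invrK; apply.
- by near=> t; exact: am_F.
- near=> t; exact: (der_continuous is_derive_F).
- exact: is_derive_F.
- by rewrite gt_eqF// g_gt0.
Unshelve. all: by end_near. Qed.

Let g_periodic t : g (t + pi) = g t.
Proof. by rewrite /g /delta sinDpi sqrrN. Qed.

Let F_odd t : F (- t) = - F t.
Proof.
have D y : is_derive y 1 (fun s => - F (- s)) (g y).
  have := derN (der_comp (is_derive_F (- y)) (derN (der_id y))).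
  by rewrite mulrN1 opprK /g /delta sinN sqrrN.
have := der_eq D is_derive_F t.
by rewrite oppr0 F0 oppr0 add0r addr0 => <-; rewrite opprK.
Qed.

Let F_Dpi t : F (t + pi) = F t + 2 * F (pi / 2).
Proof.
have P s : F (s + pi) = F s + F pi.
  exact: (prim_periodic s continuous_g g_periodic).
rewrite P; congr (_ + _); have := P (- (pi / 2)).
rewrite (_ : - (pi / 2) + pi = pi / 2); last by field.
rewrite F_odd; lra.
Qed.

Let F_pihalf_gt0 : 0 < F (pi / 2).
Proof. by rewrite -F0 ltr_F// divr_gt0// pi_gt0. Qed.

Let e (z : R) : R := (Num.sqrt ((1 - z ^+ 2) * (1 - k ^+ 2 * z ^+ 2)))^-1.

Let continuous_e (z : R) : -1 < z < 1 -> {for z, continuous e}.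
Proof.
move=> /andP[z1 z2].
have pos : 0 < (1 - z ^+ 2) * (1 - k ^+ 2 * z ^+ 2).
  have z21 : z ^+ 2 < 1 by nra.
  by rewrite mulr_gt0 ?subr_gt0// -subr_gt0 delta2_gt0// ltW.
have d1 n := @derX R id z 1 n (der_id z).
have d := derM (derD (der_cst 1 z) (derN (d1 1)))
  (derD (der_cst 1 z) (derN (derM (der_cst (k ^+ 2) z) (d1 1)))).
have d' := @der_sqrt R (fun z => (1 - z ^+ 2) * (1 - k ^+ 2 * z ^+ 2)) z _ pos d.
have nz : Num.sqrt ((1 - z ^+ 2) * (1 - k ^+ 2 * z ^+ 2)) != 0.
  by rewrite gt_eqF// sqrtr_gt0.
have [de _] := @derV R
  (fun z => Num.sqrt ((1 - z ^+ 2) * (1 - k ^+ 2 * z ^+ 2))) z _ nz d'.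
exact/differentiable_continuous/derivable1_diffP.
Qed.

(** The substitution z = sin t turns the algebraic form of the integral, over
    an interval that avoids the singularity at 1, into the trigonometric one. *)
Let algebraic_integral t : 0 <= t < pi / 2 ->
  (\int[mu]_(z in `[0%R, sin t])
(e z)%:E = (F t)%:E)%E.
Proof.
move=> /andP[t0 tpi].
have pi0 := pi_gt0 R.
rewrite -[X in `[X, _]]sin0.
have dsin : (@sin R)^`()%classic = cos.
  by apply/funext => x; exact: der_derive1 (is_derive_sin x).
have ccos : continuous (@cos R) by exact: der_continuous (@is_derive_cos R).
have csin : continuous (@sin R) by exact: der_continuous (@is_derive_sin R).
rewrite integration_by_substitution_increasing//.
- rewrite dsin -[F t]/(prim g t) /prim t0 /Rintegral fineK; last first.
    by apply: integrable_fin_num => //; exact: integrable_itv.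
  apply: eq_integral => x; rewrite inE/= in_itv/= => /andP[x0 xt]; congr EFin.
  rewrite -[LHS]/(_ * cos x) /= /e.
  have cx : 0 < cos x by apply: cos_gt0_pihalf; apply/andP; split; lra.
  rewrite -cos2sin2 sqrtrM ?sqr_ge0// sqrtr_sqr gtr0_norm// -/(delta x) /g.
  by field; rewrite !gt_eqF.
- move=> x y; rewrite !in_itv/= => /andP[x0 xt] /andP[y0 yt] xy.
  by rewrite ltr_sin// in_itv/=; apply/andP; split; lra.
- by rewrite dsin => x _; exact: ccos.
- rewrite dsin; apply/cvg_ex; exists (cos 0).
  by apply: cvg_at_right_filter; exact: ccos.
- rewrite dsin; apply/cvg_ex; exists (cos t).
  by apply: cvg_at_left_filter; exact: ccos.
- split; first by move=> x _; case: (is_derive_sin x).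
  + by apply: cvg_at_right_filter; exact: csin.
  + by apply: cvg_at_left_filter; exact: csin.
- apply: continuous_in_subspaceT => z; rewrite inE/= in_itv/= sin0 => /andP[z0 zt].
  apply: continuous_e; apply/andP; split; first lra.
  by rewrite (le_lt_trans zt)// -sin_pihalf ltr_sin// in_itv/=; apply/andP; split; lra.
Qed.

(** The algebraic form is an improper integral: monotone convergence on the
    intervals from 0 to sin (t n) exhausts it. *)
Lemma ellipticKE : ellipticK k = ellipticF k (pi / 2).
Proof.
have pi0 := pi_gt0 R.
pose t n : R := pi / 2 - pi / 2 * harmonic n.
have h1 n : 0 < @harmonic R n <= 1.
  by rewrite /harmonic/= invr_gt0 ltr0n/= invf_le1 ?ltr0n// ler1n.
have t_itv n : 0 <= t n < pi / 2.
  by have /andP[? ?] := h1 n; rewrite /t; apply/andP; split; nra.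
have t_cvg : t n @[n --> \oo] --> pi / 2.
  rewrite -[X in _ --> X]subr0; apply: cvgB; first exact: cvg_cst.
  rewrite -[X in _ --> X](mulr0 (pi / 2)); apply: cvgM; first exact: cvg_cst.
  exact: cvg_harmonic.
have t_le n m : (n <= m)%N -> t n <= t m.
  move=> nm; rewrite /t lerD2l lerN2 ler_pM2l ?divr_gt0// /harmonic/=.
  by rewrite lef_pV2 ?posrE ?ltr0n// ler_nat.
have sin_le n m : (n <= m)%N -> sin (t n) <= sin (t m).
  move=> nm; have /andP[? ?] := t_itv n; have /andP[? ?] := t_itv m.
  have := t_le _ _ nm; rewrite le_eqVlt => /predU1P[->//|tt].
  by rewrite ltW// ltr_sin// in_itv/=; apply/andP; split; lra.
have sin_lt1 n : sin (t n) < 1.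
  have /andP[? ?] := t_itv n.
  by rewrite -sin_pihalf ltr_sin// in_itv/=; apply/andP; split; lra.
have bigE : \bigcup_n `[0%R, sin (t n)]%classic = `[0%R, 1%R[%classic :> set R.
  apply/seteqP; split => [x [n _]/=|x/=]; rewrite !in_itv/= => /andP[x0 x1].
    by rewrite x0/= (le_lt_trans x1).
  have csin : sin (t n) @[n --> \oo] --> (1 : R).
    rewrite -sin_pihalf; apply: continuous_cvg => //.
    exact: (der_continuous (@is_derive_sin R)).
  have [n _ xn] : \forall n \near \oo, x <= sin (t n).
    by near=> n; apply: ltW; near: n; exact: (cvgr_gt _ csin).
  by exists n => //=; rewrite in_itv/= x0/= (xn n)//=.
have me : measurable_fun `[(0 : R), (1 : R)[%classic e.
  apply: (@measurable_funS _ _ _ _ `](-1 : R), (1 : R)[%classic) => //.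
    by move=> x/=; rewrite !in_itv/= => /andP[? ?]; apply/andP; split; lra.
  apply: open_continuous_measurable_fun; first exact: interval_open.
  by move=> x; rewrite inE/= in_itv/= => ?; exact: continuous_e.
have cv : (F (t n))%:E @[n --> \oo] --> (\int[mu]_(x in `[0%R, 1%R[) (e x)%:E)%E.
  have -> : (fun n => (F (t n))%:E) =
      (fun n => \int[mu]_(x in `[0%R, sin (t n)]%classic) (EFin \o e) x)%E.
    by apply/funext => n; rewrite -algebraic_integral.
  rewrite -bigE; apply: ge0_nondecreasing_set_cvg_integral.
  - move=> n m nm; rewrite subsetEset => x/=; rewrite !in_itv/= => /andP[-> xn]/=.
    by rewrite (le_trans xn)// sin_le.
  - by move=> n; exact: measurable_itv.
  - move=> n; apply/measurable_EFinP; apply: measurable_funS me => //.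
    move=> x/=; rewrite !in_itv/= => /andP[-> xn]/=.
    by rewrite (le_lt_trans xn).
  - by move=> n x _; rewrite lee_fin invr_ge0 sqrtr_ge0.
have cvF : (F (t n))%:E @[n --> \oo] --> (F (pi / 2))%:E.
  apply: cvg_EFin; first by near=> n.
  by apply: continuous_cvg => //; exact: (der_continuous is_derive_F).
have E := cvg_unique (@ereal_hausdorff R) cv cvF.
rewrite /ellipticK /Rintegral -integral_itv_bndo_bndc; last exact/measurable_EFinP.
by rewrite E.
Unshelve. all: by end_near. Qed.

Lemma ellipticK_gt0 : 0 < ellipticK k.
Proof. by rewrite ellipticKE F_pihalf_gt0. Qed.

Lemma am_period u : jacobi_am k (u + 2 * ellipticK k) = jacobi_am k u + pi.
Proof.
have F_am v : F (jacobi_am k v) = v by exact: ellipticF_am.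
by apply: F_inj; rewrite F_Dpi !F_am ellipticKE.
Qed.

End elliptic_functions.


(** * The wave profile and Lame's equation *)

(** The functions sn, cn, dn of argument al * (x - xi) and modulus k, through
    the properties of them that the sequel depends on; [T] is half of the
    period of sn and cn. *)
Record jacobi_triple (R : realType) (al k T xi : R) (S C D : R -> R) : Prop := {
  jt_al : 0 < al;
  jt_k : 0 < k ^+ 2 < 1;
  jt_T : 0 < T;
  jt_S : forall x : R, is_derive x (1 : R) S (al * C x * D x);
  jt_C : forall x : R, is_derive x (1 : R) C (- (al * S x * D x));
  jt_D : forall x : R, is_derive x (1 : R) D (- (al * k ^+ 2 * S x * C x));
  jt_C2 : forall x : R, C x ^+ 2 = 1 - S x ^+ 2;
  jt_D2 : forall x : R, D x ^+ 2 = 1 - k ^+ 2 * S x ^+ 2;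
  jt_ST : forall x : R, S (x + T) = - S x;
  jt_CT : forall x : R, C (x + T) = - C x;
  jt_DT : forall x : R, D (x + T) = D x;
  jt_S0 : S xi = 0 }.

Section travelling_wave.
Context {R : realType}.
Variables (al k T xi : R) (S C D : R -> R).
Hypothesis H : jacobi_triple al k T xi S C D.
Implicit Types x : R.
Let dS := jt_S H.
Let dC := jt_C H.
Let dD := jt_D H.
Let C2 := jt_C2 H.
Let D2 := jt_D2 H.

Lemma jt_S2 x : 0 <= S x ^+ 2 <= 1.
Proof. by have := sqr_ge0 (C x); have := sqr_ge0 (S x); rewrite C2; lra. Qed.

(** The coefficient c - phi of the linearized operator along a wave of
    amplitude 12 (al k)^2: six times the potential of the Lame operator whose
    eigenfunctions enter the unstable mode, up to a constant. *)
Definition lame_coef x : R :=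
  al ^+ 2 * (12 * k ^+ 2 * S x ^+ 2 - 4 - 4 * k ^+ 2).

Lemma wave_derivatives (c : R) :
  let phi x := c - lame_coef x in
  exists phi1 phi2 : R -> R,
  [/\ forall x : R, is_derive x (1 : R) phi (phi1 x),
      forall x : R, is_derive x (1 : R) phi1 (phi2 x) &
      forall x : R, is_derive x (1 : R) phi2 (lame_coef x * phi1 x)].
Proof.
move=> phi.
pose P x := S x * C x * D x.
have dP (x : R) : is_derive x 1 P (al * (C x ^+ 2 * D x ^+ 2 - S x ^+ 2 * D x ^+ 2
    - k ^+ 2 * S x ^+ 2 * C x ^+ 2)).
  by apply: (is_derive_eq (derM (derM (dS x) (dC x)) (dD x))); ring.
pose Q x := C x ^+ 2 * D x ^+ 2 - S x ^+ 2 * D x ^+ 2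
  - k ^+ 2 * S x ^+ 2 * C x ^+ 2.
have dQ (x : R) : is_derive x 1 Q
    (al * (- 4 - 4 * k ^+ 2 + 12 * k ^+ 2 * S x ^+ 2) * P x).
  have dS2 := derX 1 (dS x); have dC2 := derX 1 (dC x); have dD2 := derX 1 (dD x).
  apply: (is_derive_eq (derD (derD (derM dC2 dD2) (derN (derM dS2 dD2)))
    (derN (derM (derM (der_cst (k ^+ 2) x) dS2) dC2)))).
  by rewrite /P; ring: (C2 x) (D2 x).
exists (fun x => - (24 * al ^+ 3 * k ^+ 2) * P x),
       (fun x => - (24 * al ^+ 4 * k ^+ 2) * Q x); split=> x.
- apply: (is_derive_eq (derD (der_cst c x) (derN (derM (der_cst (al ^+ 2) x)
    (derD (derD (derM (der_cst (12 * k ^+ 2) x) (derX 1 (dS x)))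
      (der_cst (- 4) x)) (der_cst (- (4 * k ^+ 2)) x)))))).
  by rewrite /P; ring.
- apply: (is_derive_eq (derM (der_cst (- (24 * al ^+ 3 * k ^+ 2)) x) (dP x))).
  by rewrite /Q; ring.
- apply: (is_derive_eq (derM (der_cst (- (24 * al ^+ 4 * k ^+ 2)) x) (dQ x))).
  by rewrite /lame_coef; ring.
Qed.

End travelling_wave.

Section lame_function.
Context {R : realType}.
Variables (al k T xi : R) (S C D : R -> R).
Hypothesis H : jacobi_triple al k T xi S C D.
Implicit Types x : R.
Let dS := jt_S H.
Let dC := jt_C H.
Let dD := jt_D H.
Let C2 := jt_C2 H.
Let D2 := jt_D2 H.

Definition lame_den (b x : R) : R := 1 - k ^+ 2 * b * S x ^+ 2.

Lemma lame_den_gt (b x : R) : 0 <= b <= 1 -> 1 - k ^+ 2 <= lame_den b x.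
Proof.
move=> /andP[b0 b1]; have /andP[k0 k1] := jt_k H; have /andP[S0 S1] := jt_S2 H x.
rewrite /lame_den lerD2l lerN2 -mulrA ler_piMr//; first exact: ltW.
by rewrite mulr_ile1.
Qed.

Lemma lame_den_gt0 (b x : R) : 0 <= b <= 1 -> 0 < lame_den b x.
Proof.
move=> b01; have /andP[_ k1] := jt_k H.
by rewrite (lt_le_trans _ (lame_den_gt x b01))// subr_gt0.
Qed.

(** The exponent of a Floquet solution over a period is the integral of this
    function times [- q * r], with [b = q ^+ 2]. *)
Definition lame_rate (b x : R) : R := al * k ^+ 2 * S x ^+ 2 / lame_den b x.

Lemma is_derive_lame_den b x :
  is_derive x 1 (lame_den b) (- (2 * al * k ^+ 2 * b * S x * C x * D x)).
Proof.
apply: (is_derive_eq (derD (der_cst 1 x) (derN (derM (der_cst (k ^+ 2 * b) x)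
  (derX 1 (dS x)))))).
by ring.
Qed.

Lemma continuous_lame_rate b : 0 <= b <= 1 -> continuous (lame_rate b).
Proof.
move=> b01.
have dV x := derV (lt0r_neq0 (lame_den_gt0 x b01)) (is_derive_lame_den b x).
have dS2 x := derM (der_cst (al * k ^+ 2) x) (derX 1 (dS x)).
exact: (der_continuous (fun x => derM (dS2 x) (dV x))).
Qed.

Lemma lame_rate_periodic b x : lame_rate b (x + T) = lame_rate b x.
Proof. by rewrite /lame_rate /lame_den (jt_ST H) sqrrN. Qed.

Variables q r : R.
Hypothesis q1 : q ^+ 2 <= 1.
Hypothesis r2 : r ^+ 2 = (1 - q ^+ 2) * (1 - k ^+ 2 * q ^+ 2).
Let b01 : 0 <= q ^+ 2 <= 1.
Proof. by rewrite sqr_ge0. Qed.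
Let den_gt0 x := lame_den_gt0 x b01.

Definition lame_growth x : R := prim (lame_rate (q ^+ 2)) x.

Let h x := expR (- (q * r * lame_growth x) - ln (lame_den (q ^+ 2) x) / 2).

(** A Floquet solution of the Lame equation psi'' = (2 k^2 sn^2 - E) psi. With
    q = sn a and r = cn a dn a this is Hermite's solution
    H(u + a) / Theta(u) exp(- u Z(a)), up to a constant factor: the Jacobi theta
    functions are eliminated with the addition formula for sn(u + a) and an
    integral in the exponent. *)
Definition lame_sol x : R := (S x * r + q * C x * D x) * h x.

Definition lame_sol' x : R :=
  al * (C x * D x * r - q * S x * (1 + k ^+ 2 - k ^+ 2 * q ^+ 2 - k ^+ 2 * S x ^+ 2))
  * h x.

Definition lame_pot x : R :=
  al ^+ 2 * (2 * k ^+ 2 * S x ^+ 2 - (1 + k ^+ 2 - k ^+ 2 * q ^+ 2)).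

Let is_derive_h x : is_derive x 1 h (al * k ^+ 2 * q * S x *
  (q * C x * D x - r * S x) / lame_den (q ^+ 2) x * h x).
Proof.
have dG := is_derive_prim x (continuous_lame_rate b01).
have dln := der_comp (is_derive1_ln (den_gt0 x)) (is_derive_lame_den (q ^+ 2) x).
have d := derD (derN (derM (der_cst (q * r) x) dG)) (derN (derM dln (der_cst 2^-1 x))).
apply: (is_derive_eq (der_comp (is_derive_expR _) d)).
rewrite -/(lame_growth x) -/(h x) /lame_rate; field.
by rewrite gt_eqF.
Qed.

Lemma is_derive_lame_sol x : is_derive x 1 lame_sol (lame_sol' x).
Proof.
have d := derM (derD (derM (dS x) (der_cst r x))
  (derM (derM (der_cst q x) (dC x)) (dD x))) (is_derive_h x).
apply: (is_derive_eq d); rewrite /lame_sol'.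
have := den_gt0 x; rewrite /lame_den => den0.
field: (C2 x) (D2 x) r2.
by rewrite !exprMn gt_eqF.
Qed.

Lemma is_derive_lame_sol' x : is_derive x 1 lame_sol' (lame_pot x * lame_sol x).
Proof.
have dX := derD (derM (derM (dC x) (dD x)) (der_cst r x))
  (derN (derM (derM (der_cst q x) (dS x))
    (derD (der_cst (1 + k ^+ 2 - k ^+ 2 * q ^+ 2) x)
      (derN (derM (der_cst (k ^+ 2) x) (derX 1 (dS x))))))).
apply: (is_derive_eq (derM (derM (der_cst al x) dX) (is_derive_h x))).
have := den_gt0 x; rewrite /lame_sol /lame_pot /lame_den => den0.
field: (C2 x) (D2 x) r2.
by rewrite !exprMn gt_eqF.
Qed.

(** The Floquet solutions are eigenfunctions of the third order operator that
    commutes with the Lame operator; modulo the Lame equation this is a first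
    order equation, in which [- q * r] is the eigenvalue up to a factor. *)
Lemma lame_sol_first_order x :
  (S x ^+ 2 - q ^+ 2) * lame_sol' x
  = al * (S x * C x * D x - q * r) * lame_sol x.
Proof. by rewrite /lame_sol /lame_sol'; ring: (C2 x) (D2 x) r2. Qed.

(** The derivative of the first order equation, second derivatives being
    eliminated by Lame's equation. *)
Lemma lame_sol_first_order' x :
  2 * al * (S x * C x * D x) * lame_sol' x
    + (S x ^+ 2 - q ^+ 2) * (lame_pot x * lame_sol x)
  = al ^+ 2 * (C x ^+ 2 * D x ^+ 2 - S x ^+ 2 * D x ^+ 2
       - k ^+ 2 * S x ^+ 2 * C x ^+ 2) * lame_sol x
    + al * (S x * C x * D x - q * r) * lame_sol' x.
Proof. by rewrite /lame_sol /lame_sol' /lame_pot; ring: (C2 x) (D2 x) r2. Qed.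

Lemma lame_sol_period x : lame_sol (x + T) =
  - lame_sol x * expR (- (q * r * prim (lame_rate (q ^+ 2)) T)).
Proof.
rewrite /lame_sol /h /lame_growth.
rewrite (prim_periodic x (continuous_lame_rate b01) (lame_rate_periodic _)).
rewrite /lame_den (jt_ST H) (jt_CT H) (jt_DT H) sqrrN mulrDr opprD.
rewrite addrAC expRD; ring.
Qed.

(** A value at which the product of two solutions is visibly not 0. *)
Lemma lame_sol_xi : q != 0 -> lame_sol xi != 0.
Proof.
move=> q0; rewrite /lame_sol (jt_S0 H) mul0r add0r.
have CD : C xi ^+ 2 * D xi ^+ 2 = 1.
  by rewrite C2 D2 (jt_S0 H) expr0n/= mulr0 subr0 mulr1.
rewrite mulf_neq0//; last by rewrite gt_eqF ?expR_gt0.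
rewrite -mulrA mulf_neq0//.
by rewrite -sqrf_eq0 exprMn CD oner_eq0.
Qed.

End lame_function.

(** * Two energies with the same exponent *)

Section exponent_pairing.
Context {R : realType}.
Variables (al k T xi : R) (S C D : R -> R).
Hypothesis H : jacobi_triple al k T xi S C D.
Implicit Types x b be : R.

Let f b := lame_rate al k S b.
Let G b := prim (f b) T.

Let k01 := jt_k H.
Let T0 := jt_T H.
Let al0 := jt_al H.

Let cf b : 0 <= b <= 1 -> continuous (f b).
Proof. exact: (continuous_lame_rate H). Qed.

Let fT b x : f b (x + T) = f b x.
Proof. exact: (lame_rate_periodic H). Qed.

Lemma sn_neq0 : exists x, S x != 0.
Proof.
apply/not_existsP => S0; have {}S0 x : S x = 0 by apply/eqP/negPn/negP; exact: S0.
have SE : S = cst 0 by apply/funext.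
have := der_derive1 (jt_S H 0); rewrite {1}SE (der_derive1 (der_cst 0 0)).
move/esym/eqP; rewrite !mulf_eq0 -(sqrf_eq0 (C _)) -(sqrf_eq0 (D _)).
rewrite (jt_C2 H) (jt_D2 H) S0 expr0n/= mulr0 subr0 oner_eq0 !orbF.
by rewrite gt_eqF.
Qed.

Let G_gt0 b : 0 <= b <= 1 -> 0 < G b.
Proof.
move=> b01; have [x Sx] := sn_neq0; have /andP[k0 _] := k01.
apply: (prim_gt0 (cf b01) (fT b) T0 (x0 := x)) => [y|].
  apply: divr_ge0; last exact: ltW (lame_den_gt0 H _ b01).
  by apply: mulr_ge0; rewrite ?sqr_ge0// mulr_ge0 ?(ltW al0) ?(ltW k0).
rewrite /f /lame_rate; apply: divr_gt0; last exact: (lame_den_gt0 H).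
apply: mulr_gt0; first exact: mulr_gt0.
by rewrite lt_neqAle sqr_ge0 andbT eq_sym sqrf_eq0.
Qed.

Let fB b b' x : 0 <= b <= 1 -> 0 <= b' <= 1 -> f b' x - f b x =
  al * k ^+ 4 * S x ^+ 4 / (lame_den k S b x * lame_den k S b' x) * (b' - b).
Proof.
move=> b01 b01'; rewrite /f /lame_rate.
have := lame_den_gt0 H x b01; have := lame_den_gt0 H x b01'.
rewrite /lame_den => h1 h2; field.
by rewrite !gt_eqF.
Qed.

Let GB b b' : 0 <= b <= 1 -> 0 <= b' <= 1 ->
  G b' - G b = prim (fun x => f b' x - f b x) T.
Proof. by move=> b01 b01'; rewrite primB//; exact: cf. Qed.

Let G_incr b b' : 0 <= b <= 1 -> 0 <= b' <= 1 -> b < b' -> G b < G b'.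
Proof.
move=> b01 b01' bb'; rewrite -subr_gt0 GB//.
have [x Sx] := sn_neq0; have /andP[k0 _] := k01.
have c0 y : 0 <= f b' y - f b y.
  rewrite fB// mulr_ge0 ?subr_ge0 ?(ltW bb')//.
  apply: divr_ge0; last by rewrite mulr_ge0 ?(ltW (lame_den_gt0 H _ _)).
  apply: mulr_ge0; last exact: exprn_even_ge0.
  by apply: mulr_ge0; [exact: ltW|exact: exprn_even_ge0].
apply: (prim_gt0 _ _ T0 c0 (x0 := x)).
- by move=> y; apply: continuousB; [exact: (cf b01')|exact: (cf b01)].
- by move=> y; rewrite !fT.
rewrite fB// mulr_gt0 ?subr_gt0//.
apply: divr_gt0; last by rewrite mulr_gt0 ?(lame_den_gt0 H).
apply: mulr_gt0; first apply: mulr_gt0 => //.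
- by rewrite (exprM k 2 2) exprn_gt0.
- by rewrite exprn_even_gt0//= Sx orbT.
Qed.

Let L := al * k ^+ 4 / (1 - k ^+ 2) ^+ 2 * T.

Let G_lip b b' : 0 <= b <= 1 -> 0 <= b' <= 1 -> `|G b' - G b| <= L * `|b' - b|.
Proof.
move=> b01 b01'; rewrite GB//; have /andP[k0 k1] := k01.
have cB : continuous (fun x => f b' x - f b x).
  by move=> y; apply: continuousB; [exact: (cf b01')|exact: (cf b01)].
have [c _] := der_MVT (fun x => is_derive_prim x cB) (ltW T0).
rewrite prim0 !subr0 fB// => ->.
have S1 := jt_S2 H c.
have d0 := lame_den_gt H c b01; have d0' := lame_den_gt H c b01'.
have kk : 0 < 1 - k ^+ 2 by rewrite subr_gt0.
have k4 : 0 <= k ^+ 4 by rewrite exprn_even_ge0.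
have S4 : 0 <= S c ^+ 4 by rewrite exprn_even_ge0.
have S41 : S c ^+ 4 <= 1.
  by rewrite (exprM (S c) 2 2); case/andP: S1 => *; exact: exprn_ile1.
have p0 := lame_den_gt0 H c b01; have p0' := lame_den_gt0 H c b01'.
have X0 : 0 <= al * k ^+ 4 * S c ^+ 4.
  by apply: mulr_ge0 => //; apply: mulr_ge0 => //; exact: ltW.
have P0 := mulr_gt0 p0 p0'.
rewrite normrM (gtr0_norm T0) normrM (ger0_norm (divr_ge0 X0 (ltW P0))).
rewrite [leRHS]mulrAC ler_wpM2r ?(ltW T0)// ler_wpM2r ?normr_ge0//.
apply: ler_pM => //.
- by rewrite invr_ge0 ltW.
- by apply: (ler_piMr _ S41); apply: mulr_ge0 => //; exact: ltW.
- rewrite lef_pV2 ?posrE ?(mulr_gt0 p0 p0') ?(exprn_gt0 2 kk)// expr2.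
  by apply: ler_pM => //; exact: ltW.
Qed.

(** Up to sign, the exponent of the Floquet solution with q = sin be. The energies
    1 + k^2 - k^2 sin^2 be, for be between 0 and pi / 2, fill the gap. *)
Let m be :=
  sin be * (cos be * Num.sqrt (1 - k ^+ 2 * sin be ^+ 2)) * G (sin be ^+ 2).

Let sin2_01 be : 0 <= sin be ^+ 2 <= 1.
Proof. by rewrite sqr_ge0 sin2_le1. Qed.

Let csin : continuous (@sin R).
Proof. exact: (der_continuous (@is_derive_sin R)). Qed.

Let csin2 : continuous (fun be : R => sin be ^+ 2).
Proof. exact: (der_continuous (fun x => derX 1 (is_derive_sin x))). Qed.

Let continuous_G : continuous (fun be => G (sin be ^+ 2)).
Proof.
move=> be; apply/cvgrPdist_lt => e e0.
have L0 : 0 < L.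
  have /andP[k0 k1] := k01; apply: mulr_gt0 => //.
  apply: divr_gt0; last by rewrite exprn_gt0// subr_gt0.
  by apply: mulr_gt0 => //; rewrite (exprM k 2 2) exprn_gt0.
have key : \forall t \near be, `|sin be ^+ 2 - sin t ^+ 2| < e / L.
  by have /cvgrPdist_lt := @csin2 be; apply; rewrite divr_gt0.
near=> t; rewrite (le_lt_trans (G_lip _ _))// -ltr_pdivlMl// mulrC.
by near: t; exact: key.
Unshelve. all: by end_near. Qed.

Let continuous_m : continuous m.
Proof.
have /andP[_ k1] := k01.
have cd := der_continuous (is_derive_delta k1).
move=> be; rewrite /continuous_at /m.
apply: cvgM; last exact: continuous_G.
apply: cvgM; first exact: csin.
apply: cvgM; last exact: cd.
exact: (der_continuous (@is_derive_cos R)).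
Qed.

(** The exponent vanishes at both ends of the gap and is positive inside. Of two
    interior points, the smaller value is taken again beyond the other one. *)
Lemma paired_exponents : exists2 be : R * R,
  0 < be.1 < be.2 /\ be.2 < pi / 2 & m be.1 = m be.2.
Proof.
have pi0 := pi_gt0 R.
have m_gt0 be : 0 < be < pi / 2 -> 0 < m be.
  move=> /andP[b0 b1]; apply: mulr_gt0; last exact: G_gt0.
  have /andP[_ k1] := k01.
  apply: mulr_gt0; first by apply: sin_gt0_pihalf; rewrite b0.
  apply: mulr_gt0; first by apply: cos_gt0_pihalf; apply/andP; split; lra.
  by rewrite sqrtr_gt0 delta2_gt0// sin2_le1.
have m0 : m 0 = 0 by rewrite /m sin0 !mul0r.
have m1 : m (pi / 2) = 0 by rewrite /m cos_pihalf mul0r mulr0 mul0r.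
pose x : R := pi / 6; pose y : R := pi / 3.
have mx : 0 < m x by apply: m_gt0; rewrite /x; apply/andP; split; lra.
have my : 0 < m y by apply: m_gt0; rewrite /y; apply/andP; split; lra.
have wm a b : {within `[a, b], continuous m} by exact: continuous_subspaceT.
have [le_xy|lt_yx] := leP (m x) (m y).
- have yp : y <= pi / 2 by rewrite /y; lra.
  have v : Num.min (m y) (m (pi / 2)) <= m x <= Num.max (m y) (m (pi / 2)).
    by rewrite m1 ge_min le_max (ltW mx) le_xy orbT.
  have [be] := IVT yp (@wm _ _) v; rewrite in_itv/= => /andP[yb bp] mb.
  exists (x, be) => //=; split.
    have xy : x < y by rewrite /x /y; lra.
    by rewrite (lt_le_trans xy yb) andbT /x divr_gt0.
  rewrite lt_neqAle bp andbT; apply/eqP => bE.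
  by move: mx; rewrite -mb bE m1 ltxx.
- have x0 : 0 <= x by rewrite /x; lra.
  have v : Num.min (m 0) (m x) <= m y <= Num.max (m 0) (m x).
    by rewrite m0 ge_min le_max (ltW my) (ltW lt_yx) orbT.
  have [be] := IVT x0 (@wm _ _) v; rewrite in_itv/= => /andP[b0 bx] mb.
  have xy : x < y by rewrite /x /y; lra.
  exists (be, y) => /=; last by [].
  split; last by rewrite /y; lra.
  rewrite (le_lt_trans bx xy) andbT.
  rewrite lt_neqAle b0 andbT; apply/eqP => bE.
  by move: my; rewrite -mb -bE m0 ltxx.
Qed.

(** Equal exponents are equal products of [q * r] and of an integral, and the
    integrals increase strictly with q^2; so the factors [q * r] are ordered the
    other way. Their difference becomes the eigenvalue. *)
Lemma paired_parameters : exists q1 r1 q2 r2 : R,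
  [/\ 0 < q1 < q2 /\ q2 <= 1,
      r1 ^+ 2 = (1 - q1 ^+ 2) * (1 - k ^+ 2 * q1 ^+ 2),
      r2 ^+ 2 = (1 - q2 ^+ 2) * (1 - k ^+ 2 * q2 ^+ 2),
      q2 * r2 < q1 * r1 &
      q1 * r1 * prim (lame_rate al k S (q1 ^+ 2)) T
      = q2 * r2 * prim (lame_rate al k S (q2 ^+ 2)) T].
Proof.
have [[b1 b2]/= [/andP[b10 b12] b2p] mm] := paired_exponents.
have pi0 := pi_gt0 R.
have s12 : sin b1 < sin b2 by rewrite ltr_sin// in_itv/=; apply/andP; split; lra.
have s1 : 0 < sin b1 by apply: sin_gt0_pihalf; apply/andP; split; lra.
have s2 : sin b2 <= 1 by exact: sin_le1.
have /andP[_ k1] := k01.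
pose r be := cos be * Num.sqrt (1 - k ^+ 2 * sin be ^+ 2).
have r2 be : r be ^+ 2 = (1 - sin be ^+ 2) * (1 - k ^+ 2 * sin be ^+ 2).
  rewrite /r exprMn sqr_sqrtr ?cos2sin2//.
  by apply/ltW; rewrite delta2_gt0// sin2_le1.
exists (sin b1), (r b1), (sin b2), (r b2); split => //.
- by rewrite s1 s12.
- have G12 : G (sin b1 ^+ 2) < G (sin b2 ^+ 2).
    by apply: G_incr => //; rewrite ltr_pXn2r// nnegrE ltW// (lt_trans s1).
  have G1 := G_gt0 (sin2_01 b1).
  have W2 : 0 < sin b2 * r b2.
    apply: mulr_gt0; first exact: lt_trans s12.
    apply: mulr_gt0; first by apply: cos_gt0_pihalf; apply/andP; split; lra.
    by rewrite sqrtr_gt0 delta2_gt0// sin2_le1.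
  move: mm; rewrite /m -/(r b1) -/(r b2) => mm.
  by rewrite -(ltr_pM2r G1) mm ltr_pM2l.
Qed.

End exponent_pairing.

(** * The growing mode *)

(** A mode v(x, y) = z'(x) cos(kk y) growing at rate lam: the equation
    lam z' = d/dx (L z') - kk^2 z that it has to satisfy is the linearized
    equation for v integrated once in x, with L = - d^2/dx^2 + Q. *)
Record growing_mode (R : realType) (T kk lam : R) (Q z z1 z2 z3 : R -> R) :
  Prop := {
  gm_kk : 0 < kk;
  gm_lam : 0 < lam;
  gm_z : forall x : R, is_derive x (1 : R) z (z1 x);
  gm_z1 : forall x : R, is_derive x (1 : R) z1 (z2 x);
  gm_z2 : forall x : R, is_derive x (1 : R) z2 (z3 x);
  gm_eq : forall x : R, is_derive x (1 : R) (fun x => - z3 x + Q x * z1 x)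
    (kk ^+ 2 * z x + lam * z1 x);
  gm_T : forall x : R, z (x + T) = z x;
  gm_neq0 : exists x, z1 x != 0 }.

(** The algebra behind the equation for products of two Lame solutions [p1] and
    [p2] with derivatives [a1] and [a2]; the defects [e1], [e2] of their first
    order equations and the derivatives [e1'], [e2'] of these vanish. *)
Lemma lame_product_identity (R : comPzRingType)
  (al k X Y N b1 b2 w1 w2 p1 a1 p2 a2 : R) :
  let U1 := al ^+ 2 * (2 * k ^+ 2 * X - (1 + k ^+ 2 - k ^+ 2 * b1)) in
  let U2 := al ^+ 2 * (2 * k ^+ 2 * X - (1 + k ^+ 2 - k ^+ 2 * b2)) in
  let V1 := 4 * al ^+ 3 * k ^+ 2 * Y in
  let V2 := 4 * al ^+ 4 * k ^+ 2 * N in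
  let Q := al ^+ 2 * (12 * k ^+ 2 * X - 4 - 4 * k ^+ 2) in
  let z := p1 * p2 in
  let z1 := a1 * p2 + p1 * a2 in
  let z2 := (U1 + U2) * z + 2 * (a1 * a2) in
  let z4 := 2 * V2 * z + 4 * V1 * z1 + (U1 + U2) * z2
    + 2 * (V1 * z1 + 2 * U1 * U2 * z + (U1 + U2) * (a1 * a2)) in
  let e1 := (X - b1) * a1 - al * (Y + w1) * p1 in
  let e2 := (X - b2) * a2 - al * (Y + w2) * p2 in
  let e1' := 2 * al * Y * a1 + (X - b1) * (U1 * p1)
    - (al ^+ 2 * N * p1 + al * (Y + w1) * a1) in
  let e2' := 2 * al * Y * a2 + (X - b2) * (U2 * p2)
    - (al ^+ 2 * N * p2 + al * (Y + w2) * a2) in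
  - z4 + (6 * V1 * z1 + Q * z2)
  - (3 * al ^+ 4 * k ^+ 4 * (b1 - b2) ^+ 2 * z
     + 4 * k ^+ 2 * al ^+ 3 * (w1 + w2) * z1)
  = 4 * k ^+ 2 * al ^+ 2 * (p2 * e1' + p1 * e2' + a2 * e1 + a1 * e2).
Proof.
move=> U1 U2 V1 V2 Q z z1 z2 z4 e1 e2 e1' e2'.
rewrite /e1 /e2 /e1' /e2' /z4 /z2 /z1 /z /Q /V1 /V2 /U1 /U2.
by ring.
Qed.

Section mode.
Context {R : realType}.
Variables (al k T xi : R) (S C D : R -> R).
Hypothesis H : jacobi_triple al k T xi S C D.
Implicit Types x : R.

(** By Lame's equation the fourth derivative of the product is a combination of
    the four products of the solutions and their first derivatives; the first
    order equations reduce (L z')' to a combination of [z] and [z1]. *)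
Lemma lame_product_equation q1 r1 q2 r2 :
    q1 ^+ 2 <= 1 -> q2 ^+ 2 <= 1 ->
    r1 ^+ 2 = (1 - q1 ^+ 2) * (1 - k ^+ 2 * q1 ^+ 2) ->
    r2 ^+ 2 = (1 - q2 ^+ 2) * (1 - k ^+ 2 * q2 ^+ 2) ->
  let z x := lame_sol al k S C D q1 r1 x * lame_sol al k S C D q2 r2 x in
  exists z1 z2 z3 : R -> R,
  [/\ forall x, is_derive x 1 z (z1 x), forall x, is_derive x 1 z1 (z2 x),
      forall x, is_derive x 1 z2 (z3 x) &
      forall x, is_derive x 1 (fun x => - z3 x + lame_coef al k S x * z1 x)
        (3 * al ^+ 4 * k ^+ 4 * (q1 ^+ 2 - q2 ^+ 2) ^+ 2 * z x
         + 4 * k ^+ 2 * al ^+ 3 * (- (q1 * r1) - q2 * r2) * z1 x)].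
Proof.
move=> q11 q21 hr1 hr2.
have := is_derive_lame_sol H q11 hr1; have := is_derive_lame_sol' H q11 hr1.
have := is_derive_lame_sol H q21 hr2; have := is_derive_lame_sol' H q21 hr2.
have := lame_sol_first_order H hr1; have := lame_sol_first_order' H hr1.
have := lame_sol_first_order H hr2; have := lame_sol_first_order' H hr2.
set p1 := lame_sol al k S C D q1 r1; set p2 := lame_sol al k S C D q2 r2.
set a1 := lame_sol' al k S C D q1 r1; set a2 := lame_sol' al k S C D q2 r2.
set U1 := lame_pot al k S q1; set U2 := lame_pot al k S q2.
move=> rel2' rel2 rel1' rel1 da2 dp2 da1 dp1 z.
pose V1 x := 4 * al ^+ 3 * k ^+ 2 * (S x * C x * D x).
have dU q x : is_derive x 1 (lame_pot al k S q) (V1 x).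
  apply: (is_derive_eq (derM (der_cst (al ^+ 2) x) (derD (derM
    (der_cst (2 * k ^+ 2) x) (derX 1 (jt_S H x))) (der_cst _ x)))).
  by rewrite /V1; ring.
pose N x := C x ^+ 2 * D x ^+ 2 - S x ^+ 2 * D x ^+ 2
  - k ^+ 2 * S x ^+ 2 * C x ^+ 2.
have dV1 x : is_derive x 1 V1 (4 * al ^+ 4 * k ^+ 2 * N x).
  apply: (is_derive_eq (derM (der_cst (4 * al ^+ 3 * k ^+ 2) x)
    (derM (derM (jt_S H x) (jt_C H x)) (jt_D H x)))).
  by rewrite /N; ring.
have dz x : is_derive x 1 z (a1 x * p2 x + p1 x * a2 x) by exact: derM.
have dz1 x : is_derive x 1 (fun x => a1 x * p2 x + p1 x * a2 x)
    ((U1 x + U2 x) * z x + 2 * (a1 x * a2 x)).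
  apply: (is_derive_eq (derD (derM (da1 x) (dp2 x)) (derM (dp1 x) (da2 x)))).
  by rewrite /z; ring.
have dz2 x : is_derive x 1 (fun x => (U1 x + U2 x) * z x + 2 * (a1 x * a2 x))
    (2 * V1 x * z x + (U1 x + U2 x) * (a1 x * p2 x + p1 x * a2 x)
     + 2 * (U1 x * p1 x * a2 x + U2 x * p2 x * a1 x)).
  apply: (is_derive_eq (derD (derM (derD (dU q1 x) (dU q2 x)) (dz x))
    (derM (der_cst 2 x) (derM (da1 x) (da2 x))))).
  by rewrite /z /U1 /U2; ring.
exists (fun x => a1 x * p2 x + p1 x * a2 x),
  (fun x => (U1 x + U2 x) * z x + 2 * (a1 x * a2 x)),
  (fun x => 2 * V1 x * z x + (U1 x + U2 x) * (a1 x * p2 x + p1 x * a2 x)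
     + 2 * (U1 x * p1 x * a2 x + U2 x * p2 x * a1 x)).
split; [exact: dz|exact: dz1|exact: dz2|move=> x].
have dz3 : is_derive x 1 (fun x => 2 * V1 x * z x
      + (U1 x + U2 x) * (a1 x * p2 x + p1 x * a2 x)
      + 2 * (U1 x * p1 x * a2 x + U2 x * p2 x * a1 x))
    (2 * (4 * al ^+ 4 * k ^+ 2 * N x) * z x
     + 4 * V1 x * (a1 x * p2 x + p1 x * a2 x)
     + (U1 x + U2 x) * ((U1 x + U2 x) * z x + 2 * (a1 x * a2 x))
     + 2 * (V1 x * (a1 x * p2 x + p1 x * a2 x) + 2 * U1 x * U2 x * z x
            + (U1 x + U2 x) * (a1 x * a2 x))).
  apply: (is_derive_eq (derD (derD (derM (derM (der_cst 2 x) (dV1 x)) (dz x))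
      (derM (derD (dU q1 x) (dU q2 x)) (dz1 x)))
    (derM (der_cst 2 x) (derD (derM (derM (dU q1 x) (dp1 x)) (da2 x))
      (derM (derM (dU q2 x) (dp2 x)) (da1 x)))))).
  by rewrite /z -/U1 -/U2; ring.
have dQ : is_derive x 1 (lame_coef al k S) (6 * V1 x).
  apply: (is_derive_eq (derM (der_cst (al ^+ 2) x) (derD (derD (derM
    (der_cst (12 * k ^+ 2) x) (derX 1 (jt_S H x))) (der_cst (- 4) x))
    (der_cst (- (4 * k ^+ 2)) x)))).
  by rewrite /V1; ring.
apply: (is_derive_eq (derD (derN dz3) (derM dQ (dz1 x)))).
apply/eqP; rewrite -subr_eq0; apply/eqP.
apply: etrans (lame_product_identity al k (S x ^+ 2) (S x * C x * D x) (N x)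
  (q1 ^+ 2) (q2 ^+ 2) (- (q1 * r1)) (- (q2 * r2)) (p1 x) (a1 x) (p2 x) (a2 x)) _.
rewrite rel1 rel2 [X in p2 x * (X - _)]rel1' [X in p1 x * (X - _)]rel2'.
by rewrite !subrr !mulr0 !addr0 mulr0.
Qed.

End mode.

Section mode_existence.
Context {R : realType}.
Variables (al k T xi : R) (S C D : R -> R).
Hypothesis H : jacobi_triple al k T xi S C D.
Implicit Types x : R.

Lemma exists_growing_mode : exists (kk lam : R) (z z1 z2 z3 : R -> R),
  growing_mode T kk lam (lame_coef al k S) z z1 z2 z3.
Proof.
have [q1 [r1 [q2 [r2 [[/andP[q1_gt0 q12] q21] hr1 hr2 W21 exponents]]]]] :=
  paired_parameters H.
have /andP[k0 k1] := jt_k H.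
have q1q1 : q1 ^+ 2 <= 1 by rewrite exprn_ile1 ?ltW// (lt_le_trans q12).
have q2q2 : q2 ^+ 2 <= 1 by rewrite exprn_ile1// ltW// (lt_trans q1_gt0).
(* The first solution grows and the second decays, with opposite exponents. *)
have q1N : (- q1) ^+ 2 <= 1 by rewrite sqrrN.
have hr1N : r1 ^+ 2 = (1 - (- q1) ^+ 2) * (1 - k ^+ 2 * (- q1) ^+ 2).
  by rewrite sqrrN.
have [z1 [z2 [z3 []]]] := lame_product_equation H q1N q2q2 hr1N hr2.
set z := fun x => _; set kk2 := 3 * al ^+ 4 * k ^+ 4 * _; set lam := 4 * _ * _ * _.
move=> dz dz1 dz2 dM.
have q1212 : 0 < q2 ^+ 2 - q1 ^+ 2.
  by rewrite subr_gt0 ltr_pXn2r// nnegrE ltW// (lt_trans q1_gt0).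
have kk2E : kk2 = 3 * (al ^+ 2 * k ^+ 2 * (q2 ^+ 2 - q1 ^+ 2)) ^+ 2.
  by rewrite /kk2; ring.
have kk2_gt0 : 0 < kk2.
  have al0 := jt_al H.
  rewrite kk2E; apply: mulr_gt0 => //; apply: exprn_gt0.
  by apply: mulr_gt0 => //; apply: mulr_gt0 => //; exact: exprn_gt0.
have lam_gt0 : 0 < lam.
  have al0 := jt_al H.
  rewrite /lam; apply: mulr_gt0; last by rewrite mulNr opprK subr_gt0.
  by apply: mulr_gt0; [apply: mulr_gt0|exact: exprn_gt0].
have kkE : Num.sqrt kk2 ^+ 2 = kk2 by rewrite sqr_sqrtr// ltW.
exists (Num.sqrt kk2), lam, z, z1, z2, z3; split.
- by rewrite sqrtr_gt0.
- exact: lam_gt0.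
- exact: dz.
- exact: dz1.
- exact: dz2.
- by move=> x; rewrite kkE; exact: dM.
- move=> x; rewrite /z (lame_sol_period H _ q1N) (lame_sol_period H _ q2q2).
  rewrite mulrACA mulrNN -expRD sqrrN !mulNr opprK exponents subrr expR0.
  by rewrite mulr1.
(* A constant [z] would vanish by the equation of the mode, but [z xi] is not 0. *)
- apply/not_existsP => z10; have {}z10 x : z1 x = 0 by apply/eqP/negPn/negP; exact: z10.
  have z1E : z1 = cst 0 by apply/funext.
  have z20 x : z2 x = 0.
    by rewrite -(der_derive1 (dz1 x)) z1E (der_derive1 (der_cst 0 x)).
  have z2E : z2 = cst 0 by apply/funext.
  have z30 x : z3 x = 0.
    by rewrite -(der_derive1 (dz2 x)) z2E (der_derive1 (der_cst 0 x)).
  have := der_derive1 (dM xi).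
  rewrite (_ : (fun x => _) = cst 0); last first.
    by apply/funext => x; rewrite z30 z10 mulr0 oppr0 addr0.
  rewrite (der_derive1 (der_cst 0 xi)) z10 mulr0 addr0 => /esym/eqP.
  have q1n : - q1 != 0 by rewrite oppr_eq0 gt_eqF.
  have q2n : q2 != 0 by rewrite gt_eqF// (lt_trans q1_gt0).
  rewrite mulf_eq0 gt_eqF//= mulf_eq0.
  by rewrite (negPf (lame_sol_xi H r1 q1n)) (negPf (lame_sol_xi H r2 q2n)).
Qed.

End mode_existence.

(** * The cnoidal wave *)

Section cnoidal_wave.
Context {R : realType}.
Variables (c phi0 phi1 xi : R).
Hypothesis h01 : phi0 < phi1.
Hypothesis hc : 3 * c < 2 * phi0 + phi1.
Let k := cnoidal_modulus c phi0 phi1.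
Let al := cnoidal_alpha c phi0 phi1.
Let T := cnoidal_period c phi0 phi1.
Let den_gt0 : 0 < phi0 + 2 * phi1 - 3 * c.
Proof. by move: h01 hc => *; lra. Qed.

Let k2E : k ^+ 2 = (phi1 - phi0) / (phi0 + 2 * phi1 - 3 * c).
Proof. by rewrite sqr_sqrtr// divr_ge0 ?(ltW den_gt0)// subr_ge0 ltW. Qed.

Let al2E : al ^+ 2 = (phi0 + 2 * phi1 - 3 * c) / 12.
Proof. by rewrite sqr_sqrtr// divr_ge0 ?(ltW den_gt0). Qed.

Lemma cnoidal_modulus_itv : 0 < k ^+ 2 < 1.
Proof.
rewrite k2E divr_gt0 ?den_gt0 ?(subr_gt0 phi0) ?h01//= ltr_pdivrMr// mul1r.
by move: h01 hc => *; lra.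
Qed.

Let theta x := jacobi_am k (al * (x - xi)).
Definition wave_sn x : R := sin (theta x).
Definition wave_cn x : R := cos (theta x).
Definition wave_dn x : R := Num.sqrt (1 - k ^+ 2 * sin (theta x) ^+ 2).

Lemma cnoidal_jacobi_triple : jacobi_triple al k T xi wave_sn wave_cn wave_dn.
Proof.
have /andP[k0 k1] := cnoidal_modulus_itv.
have al0 : 0 < al by rewrite sqrtr_gt0 divr_gt0.
have dtheta (x : R) : is_derive x 1 theta (al * wave_dn x).
  have d := derM (der_cst al x) (derD (der_id x) (der_cst (- xi) x)).
  have := @der_comp R (jacobi_am k) (fun x => al * (x - xi)) x _ _
    (is_derive_am k1 (al * (x - xi))) d.
  by move=> D; apply: (is_derive_eq D); rewrite mul0r add0r addr0 mulr1 mulrC.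
have thetaT x : theta (x + T) = theta x + pi.
  rewrite /theta -(am_period k1); congr (jacobi_am _ _).
  by rewrite /T /cnoidal_period -/al -/k; field; rewrite gt_eqF.
have pos s : 0 < 1 - k ^+ 2 * sin s ^+ 2 by rewrite delta2_gt0// sin2_le1.
split => //.
- exact: cnoidal_modulus_itv.
- by rewrite divr_gt0// mulr_gt0// ellipticK_gt0.
- move=> x; apply: (is_derive_eq (der_comp (is_derive_sin (theta x)) (dtheta x))).
  by rewrite /wave_cn; ring.
- move=> x; apply: (is_derive_eq (der_comp (is_derive_cos (theta x)) (dtheta x))).
  by rewrite /wave_sn; ring.
- move=> x; have := der_comp (is_derive_delta k1 (theta x)) (dtheta x).
  move=> D; apply: (is_derive_eq D); rewrite /wave_dn /wave_sn /wave_cn.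
  by field; rewrite gt_eqF// sqrtr_gt0.
- by move=> x; rewrite /wave_cn cos2sin2.
- by move=> x; rewrite /wave_dn sqr_sqrtr ?ltW.
- by move=> x; rewrite /wave_sn thetaT sinDpi.
- by move=> x; rewrite /wave_cn thetaT cosDpi.
- by move=> x; rewrite /wave_dn thetaT sinDpi sqrrN.
- by rewrite /wave_sn /theta subrr mulr0 (am0 k1) sin0.
Qed.

Lemma cnoidalE s : cnoidal c phi0 phi1 xi s = c - lame_coef al k wave_sn s.
Proof.
rewrite /cnoidal -/k -/al /jacobi_cn -/(theta s) cos2sin2 -/(wave_sn s).
rewrite /lame_coef k2E al2E; field.
by rewrite gt_eqF.
Qed.

End cnoidal_wave.

Section traveling_solution.
Context {R : realType}.

(** The profile only has to satisfy the equation integrated once less: then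
    the bracket whose x-derivative enters KP-I vanishes identically. *)
Lemma kp1_traveling_solution (c K1 K2 : R) (phi phi1 phi2 : R -> R) :
  (forall x, phi (x + K1) = phi x) ->
  (forall x : R, is_derive x (1 : R) phi (phi1 x)) ->
  (forall x : R, is_derive x (1 : R) phi1 (phi2 x)) ->
  (forall x : R, is_derive x (1 : R) phi2 ((c - phi x) * phi1 x)) ->
  kp1_solution K1 K2 (fun t x y => phi (x - c * t)).
Proof.
move=> phiT d0 d1 d2; set u := fun t x y : R => _.
have shift (f f' : R -> R) (t x : R) : (forall x : R, is_derive x (1 : R) f (f' x)) ->
    is_derive x 1 (fun s => f (s - c * t)) (f' (x - c * t)).
  move=> df; have := @der_comp R f (fun s => s - c * t) x _ _ (df _)
    (derD (der_id x) (der_cst (- (c * t)) x)).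
  by rewrite addr0 mulr1.
have dt (t x : R) : is_derive t 1 (fun s => phi (x - c * s)) (- c * phi1 (x - c * t)).
  have := @der_comp R phi (fun s => x - c * s) t _ _ (d0 _)
    (derD (der_cst x t) (derN (derM (der_cst c t) (der_id t)))).
  by move=> D; apply: (is_derive_eq D); rewrite mul0r !add0r mulr1 mulrC.
have ux : ddx u = fun t x y => phi1 (x - c * t).
  by apply/funext => t; apply/funext => x; apply/funext => y;
    exact: der_derive1 (shift _ _ t x d0).
have uxx : ddx (ddx u) = fun t x y => phi2 (x - c * t).
  by rewrite ux; apply/funext => t; apply/funext => x; apply/funext => y;
    exact: der_derive1 (shift _ _ t x d1).
have uxxx : ddx (ddx (ddx u)) =
    fun t x y => (c - phi (x - c * t)) * phi1 (x - c * t).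
  by rewrite uxx; apply/funext => t; apply/funext => x; apply/funext => y;
    exact: der_derive1 (shift _ _ t x d2).
have dflux (t x : R) : is_derive x 1 (fun s => kp1_flux (phi (s - c * t)))
    (phi (x - c * t) * phi1 (x - c * t)).
  have := derM (derX 1 (shift _ _ t x d0)) (der_cst 2^-1 x).
  by move=> D; apply: (is_derive_eq D); field.
have inner0 : kp1_inner u = fun t x y => 0.
  apply/funext => t; apply/funext => x; apply/funext => y.
  rewrite /kp1_inner uxxx [ddt _ _ _ _](der_derive1 (dt t x)).
  by rewrite [ddx _ _ _ _](der_derive1 (dflux t x)); ring.
have uy : ddy u = fun t x y => 0.
  apply/funext => t; apply/funext => x; apply/funext => y.
  exact: (der_derive1 (der_cst (phi (x - c * t)) y)).
have der_ex (f : R -> R) (x f' : R) : is_derive x (1 : R) f f' -> derivable f x 1 by case.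
move=> t x y t0; split.
- by split => //; rewrite /u addrAC phiT.
- exact: der_ex (dt t x).
- split; rewrite ?inner0 ?uxx ?ux.
  + exact: der_ex (shift _ _ t x d0).
  + exact: der_ex (shift _ _ t x d1).
  + exact: der_ex (shift _ _ t x d2).
  + exact: der_ex (der_cst 0 x).
- by split; rewrite ?uy; [exact: der_ex (der_cst _ y)|exact: der_ex (der_cst 0 y)].
- rewrite inner0 uy /ddx /ddy (der_derive1 (der_cst 0 x)) (der_derive1 (der_cst 0 y)).
  by rewrite subrr.
Qed.

End traveling_solution.

(** * Integrals over a period cell *)

Section plane_integrals.
Context {R : realType}.
Implicit Types g : R * R -> R.
Local Notation leb := (@lebesgue_measure R).
Local Notation leb2 := (leb \x leb)%E.
Local Notation plane := (measurableTypeR R * measurableTypeR R)%type.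

Lemma continuous_pair_comp (T : topologicalType) (a b : T -> R) g :
  continuous a -> continuous b -> continuous g -> continuous (fun t => g (a t, b t)).
Proof.
move=> ca cb cg t.
apply: (@continuous2_cvg _ _ _ _ _ _ a b (fun x y => g (x, y))); [|exact: ca|exact: cb].
rewrite (_ : (fun z : R * R => g (z.1, z.2)) = g); first exact: cg.
by apply/funext => -[].
Qed.

(** The plane is second countable: an open set is the union of the rectangles
    with rational sides that it contains. *)
Lemma open_measurable_plane (U : set (R * R)) : open U -> measurable (U : set plane).
Proof.
move=> oU.
pose rect (p : (rat * rat) * (rat * rat)) : set (R * R) :=
  `](ratr p.1.1 : R), (ratr p.1.2 : R)[%classic `*`
  `](ratr p.2.1 : R), (ratr p.2.2 : R)[%classic.
pose F p : set plane := if pselect (rect p `<=` U) then rect p else set0.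
have -> : (U : set plane) = \bigcup_p F p.
  apply/seteqP; split => [[x y] Uxy|[x y] [p _]]; last first.
    by rewrite /F; case: pselect => // sub /sub.
  have [e /= e0 eU] : exists2 e : R, 0 < e & ball ((x, y) : R * R) e `<=` U.
    have : nbhs ((x, y) : R * R) U by exact: open_nbhs_nbhs.
    by rewrite -nbhs_ballE => -[e e0 eU]; exists e.
  have near_rat (a : R) : exists q : rat * rat,
      ratr q.1 < a < ratr q.2 /\ a - e < ratr q.1 /\ ratr q.2 < a + e.
    have [q1] := @rat_in_itvoo R (a - e) a ltac:(lra).
    have [q2] := @rat_in_itvoo R a (a + e) ltac:(lra).
    rewrite !in_itv/= => /andP[h1 h2] /andP[h3 h4].
    by exists (q1, q2) => /=; rewrite h4 h1.
  have [qx [/andP[x1 x2] [x3 x4]]] := near_rat x.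
  have [qy [/andP[y1 y2] [y3 y4]]] := near_rat y.
  exists (qx, qy) => //; rewrite /F; case: pselect => [sub|].
    by rewrite /rect; split => /=; rewrite in_itv/=; apply/andP.
  case=> -[s t] /= [] /=; rewrite !in_itv/= => /andP[s1 s2] /andP[t1 t2].
  apply: eU; split => /=; rewrite /ball/= ltr_norml; apply/andP; split; lra.
apply: countable_bigcupT_measurable; first exact: countableP.
move=> i.
rewrite /F; case: pselect => [sub|?]; last exact: measurable0.
by apply: measurableX; exact: measurable_itv.
Qed.

Lemma continuous_measurable_plane g : continuous g ->
  measurable_fun [set: plane] (g : plane -> measurableTypeR R).
Proof.
move=> /continuousP cg.
apply: (measurability _ (RGenOpens.measurableE R)).
move=> _ [_ [a [b ->] <-]]; rewrite setTI.
by apply: open_measurable_plane; apply: cg; exact: interval_open.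
Qed.


Section cell.
Variables K1 K2 : R.
Hypotheses (K1_ge0 : 0 <= K1) (K2_ge0 : 0 <= K2).
Local Notation cell := (cell K1 K2 : set plane).

Lemma cellE : cell = `[0, K1]%classic `*` `[0, K2]%classic.
Proof.
by apply/seteqP; split => [[x y] []|[x y] []] /=; rewrite !in_itv.
Qed.

Lemma measurable_cell : measurable cell.
Proof. by rewrite cellE; apply: measurableX; exact: measurable_itv. Qed.

Lemma cell_measure : leb2 cell = (K1 * K2)%:E.
Proof.
rewrite cellE product_measure1E; [|exact: measurable_itv|exact: measurable_itv].
have E (K : R) : 0 <= K -> leb `[0, K]%classic = K%:E.
  move=> K0; rewrite lebesgue_measure_itv/= lte_fin oppr0 adde0.
  by case: ltP => // K0'; congr EFin; lra.
by rewrite EFinM; congr (_ * _)%E; exact: E.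
Qed.

Lemma continuous_bounded_cell g : continuous g ->
  exists M : R, forall p, cell p -> `|g p| <= M.
Proof.
move=> cg.
have cptA : compact (cell : set (R * R)).
  by rewrite cellE; apply: compact_setX; exact: segment_compact.
have cgA : {within (cell : set (R * R)), continuous g}.
  exact: continuous_subspaceT.
have /compact_bounded[M [_ HM]] := continuous_compact cgA cptA.
exists (M + 1) => p cp; apply: (HM (M + 1)); first by rewrite ltrDl.
by exists p.
Qed.

Lemma continuous_integrable_cell g : continuous g ->
  leb2.-integrable cell (EFin \o g).
Proof.
move=> cg; apply: measurable_bounded_integrable.
- exact: measurable_cell.
- by have := ltry (K1 * K2); rewrite -cell_measure.
- by apply: measurable_funS (continuous_measurable_plane cg).
- have [M HM] := continuous_bounded_cell cg.
  exists M; split; first exact: num_real.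
  by move=> N MN p cp /=; rewrite (le_trans (HM p cp))// ltW.
Qed.

Let integrable_cellT g : continuous g ->
  leb2.-integrable setT ((EFin \o g) \_ cell).
Proof.
move=> /continuous_integrable_cell ig.
by apply/(integrable_restrict _ measurable_cell); [exact: measurableT|rewrite setTI].
Qed.

Lemma in_cell x y : ((x, y) \in cell) = (x \in `[0, K1]) && (y \in `[0, K2]).
Proof.
apply/idP/andP => [/set_mem[/= xK yK]|[xK yK]]; first by rewrite !in_itv/=.
by apply/mem_set; move: xK yK; rewrite !in_itv/=.
Qed.

Lemma cell_Fubini_yx g : continuous g ->
  \int[leb2]_(p in cell) g p =
  \int[leb]_(y in `[0, K2]) \int[leb]_(x in `[0, K1]) g (x, y).
Proof.
move=> cg; have igT := integrable_cellT cg.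
have slice (y : R) : continuous (fun x : R => g (x, y)).
  by apply: continuous_pair_comp => // x; [exact: cvg_id|exact: cvg_cst].
rewrite /Rintegral [in LHS]integral_mkcond -(integral21_prod_meas1 igT).
congr fine; rewrite [RHS]integral_mkcond; apply: eq_integral => y _.
rewrite /fubini_G patchE mem_setE; case: ifPn => yK.
- rewrite fineK; last first.
    by apply: integrable_fin_num; [exact: measurable_itv|exact: integrable_itv].
  rewrite [RHS]integral_mkcond; apply: eq_integral => x _.
  by rewrite !patchE in_cell yK andbT mem_setE.
- rewrite integral0_eq// => x _.
  by rewrite patchE in_cell (negPf yK) andbF.
Qed.

Lemma cell_Fubini_xy g : continuous g ->
  \int[leb2]_(p in cell) g p =
  \int[leb]_(x in `[0, K1]) \int[leb]_(y in `[0, K2]) g (x, y).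
Proof.
move=> cg; have igT := integrable_cellT cg.
have slice (x : R) : continuous (fun y : R => g (x, y)).
  by apply: continuous_pair_comp => // y; [exact: cvg_cst|exact: cvg_id].
rewrite /Rintegral [in LHS]integral_mkcond -(integral12_prod_meas1 igT).
congr fine; rewrite [RHS]integral_mkcond; apply: eq_integral => x _.
rewrite /fubini_F patchE mem_setE; case: ifPn => xK.
- rewrite fineK; last first.
    by apply: integrable_fin_num; [exact: measurable_itv|exact: integrable_itv].
  rewrite [RHS]integral_mkcond; apply: eq_integral => y _.
  by rewrite !patchE in_cell xK mem_setE.
- rewrite integral0_eq// => y _.
  by rewrite patchE in_cell (negPf xK).
Qed.

(** Integration by parts in the form in which it is applied below: [F] collects
    the boundary terms, which cancel by periodicity. *)
Lemma cell_total_x g (F : R -> R -> R) : continuous g ->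
  (forall x y : R, is_derive x (1 : R) (F ^~ y) (g (x, y))) ->
  (forall x y, F (x + K1) y = F x y) ->
  \int[leb2]_(p in cell) g p = 0.
Proof.
move=> cg dF FK; rewrite cell_Fubini_yx//.
transitivity (\int[leb]_(y in `[0, K2]) (0 : R)); last by rewrite Rintegral_cst ?mul0r.
apply: eq_Rintegral => y _.
have slice : continuous (fun x : R => g (x, y)).
  by apply: continuous_pair_comp => // x; [exact: cvg_id|exact: cvg_cst].
by rewrite (FTC (dF ^~ y) slice)// -(FK 0) add0r subrr.
Qed.

Lemma cell_total_y g (F : R -> R -> R) : continuous g ->
  (forall x y : R, is_derive y (1 : R) (F x) (g (x, y))) ->
  (forall x y, F x (y + K2) = F x y) ->
  \int[leb2]_(p in cell) g p = 0.
Proof.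
move=> cg dF FK; rewrite cell_Fubini_xy//.
transitivity (\int[leb]_(x in `[0, K1]) (0 : R)); last by rewrite Rintegral_cst ?mul0r.
apply: eq_Rintegral => x _.
have slice : continuous (fun y : R => g (x, y)).
  by apply: continuous_pair_comp => // y; [exact: cvg_cst|exact: cvg_id].
by rewrite (FTC (dF x) slice)// -(FK x 0) add0r subrr.
Qed.

Lemma cell_tensor (a b : R -> R) : continuous a -> continuous b ->
  \int[leb2]_(p in cell) (a p.1 * b p.2) =
  \int[leb]_(x in `[0, K1]) a x * \int[leb]_(y in `[0, K2]) b y.
Proof.
move=> ca cb; have itv_int (f : R -> R) K : continuous f ->
    leb.-integrable `[0, K] (EFin \o f) by exact: integrable_itv.
rewrite cell_Fubini_yx/=; last first.
  move=> p; apply: cvgM.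
  - by apply: continuous_comp; [exact: cvg_fst|exact: ca].
  - by apply: continuous_comp; [exact: cvg_snd|exact: cb].
rewrite -RintegralZl; [|exact: measurable_itv|exact: itv_int].
apply: eq_Rintegral => y _; rewrite RintegralZr//; exact: itv_int.
Qed.

End cell.

End plane_integrals.

(** * Pairing with test functions *)

Section cell_linear.
Context {R : realType}.
Variables K1 K2 : R.
Hypotheses (K1_ge0 : 0 <= K1) (K2_ge0 : 0 <= K2).
Implicit Types f g w : R * R -> R.
Local Notation leb2 := (@lebesgue_measure R \x @lebesgue_measure R)%E.
Local Notation cell := (cell K1 K2).

Lemma contD f g : continuous f -> continuous g -> continuous (fun p => f p + g p).
Proof. by move=> cf cg p; apply: cvgD; [exact: cf|exact: cg]. Qed.

Lemma contM f g : continuous f -> continuous g -> continuous (fun p => f p * g p).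
Proof. by move=> cf cg p; apply: cvgM; [exact: cf|exact: cg]. Qed.

Lemma contN f : continuous f -> continuous (fun p => - f p).
Proof. by move=> cf p; apply: cvgN; exact: cf. Qed.

Lemma cont_cst (r : R) : continuous (fun _ : R * R => r).
Proof. by move=> p; exact: cvg_cst. Qed.

Lemma cont_fst (a : R -> R) : continuous a -> continuous (fun p : R * R => a p.1).
Proof. by move=> ca p; apply: continuous_comp; [exact: cvg_fst|exact: ca]. Qed.

Lemma cont_snd (a : R -> R) : continuous a -> continuous (fun p : R * R => a p.2).
Proof. by move=> ca p; apply: continuous_comp; [exact: cvg_snd|exact: ca]. Qed.

Lemma cellD f g : continuous f -> continuous g ->
  \int[leb2]_(p in cell) (f p + g p) =
  \int[leb2]_(p in cell) f p + \int[leb2]_(p in cell) g p.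
Proof.
move=> cf cg; rewrite RintegralD//; [exact: measurable_cell| |];
  exact: continuous_integrable_cell.
Qed.

Lemma cellZ r f : continuous f ->
  \int[leb2]_(p in cell) (r * f p) = r * \int[leb2]_(p in cell) f p.
Proof.
move=> cf; rewrite RintegralZl//; first exact: measurable_cell.
exact: continuous_integrable_cell.
Qed.

Lemma cellN f : continuous f ->
  \int[leb2]_(p in cell) (- f p) = - \int[leb2]_(p in cell) f p.
Proof.
move=> cf; rewrite -mulN1r -cellZ//.
by apply: eq_Rintegral => p _; rewrite mulN1r.
Qed.

End cell_linear.

Section test_functions.
Context {R : realType}.
Variables K1 K2 : R.
Implicit Types psi : R * R -> R.
Local Open Scope complex_scope.
Local Notation leb2 := (@lebesgue_measure R \x @lebesgue_measure R)%E.

Lemma smooth_cont psi s : smooth psi -> continuous (partials s psi : R * R -> R).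
Proof. by move=> /(_ s)[]. Qed.

Lemma smooth_dx psi s (x y : R) : smooth psi ->
  is_derive x (1 : R) (fun r => partials s psi (r, y)) (pdx (partials s psi) (x, y)).
Proof.
by move=> /(_ s)[_ /(_ (x, y))[/= d _]]; split => //; rewrite /pdx/= derive1E.
Qed.

Lemma smooth_dy psi s (x y : R) : smooth psi ->
  is_derive y (1 : R) (fun r => partials s psi (x, r)) (pdy (partials s psi) (x, y)).
Proof.
by move=> /(_ s)[_ /(_ (x, y))[/= _ d]]; split => //; rewrite /pdy/= derive1E.
Qed.

Lemma partials_biperiodic psi s : test_function K1 K2 psi ->
  biperiodic K1 K2 (partials s psi).
Proof.
move=> [sm per]; elim: s => [//|b s IH] x y.
have Px r t : partials s psi (r + K1, t) = partials s psi (r, t) by case: (IH r t).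
have Py r t : partials s psi (r, t + K2) = partials s psi (r, t) by case: (IH r t).
case: b; split.
- rewrite /= /pdy /=; congr (derive1 _ y); apply/funext => r; exact: Px.
- exact: (der_periodic (fun r => smooth_dy s x r sm) (Py x)).
- exact: (der_periodic (fun r => smooth_dx s r y sm) (Px ^~ y)).
- rewrite /= /pdx /=; congr (derive1 _ x); apply/funext => r; exact: Py.
Qed.

Lemma distr_real (w psi : R * R -> R) :
  distr K1 K2 (fun p => (w p)%:C) psi =
  (\int[leb2]_(p in cell K1 K2) (w p * psi p))%:C.
Proof.
rewrite /distr /cintegral; apply/eqP; rewrite eq_complex /=; apply/andP; split.
- by apply/eqP; apply: eq_Rintegral => p _ /=; rewrite mul0r subr0.
- apply/eqP; transitivity (\int[leb2]_(p in cell K1 K2) (0 : R)).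
    by apply: eq_Rintegral => p _ /=; rewrite mulr0 mul0r addr0.
  by rewrite /Rintegral integral0.
Qed.

Hypotheses (K1_ge0 : 0 <= K1) (K2_ge0 : 0 <= K2).

Lemma distr_real_periodic_distribution (w : R * R -> R) : continuous w ->
  periodic_distribution K1 K2 (distr K1 K2 (fun p => (w p)%:C)).
Proof.
move=> cw; split=> [a psi1 psi2 [sm1 _] [sm2 _]|].
  have c1 : continuous psi1 by exact: (smooth_cont (s := [::]) sm1).
  have c2 : continuous psi2 by exact: (smooth_cont (s := [::]) sm2).
  rewrite !distr_real -rmorphM -rmorphD; congr (_%:C).
  have cwp1 := contM cw c1; have cwp2 := contM cw c2.
  rewrite -(cellZ K1_ge0 K2_ge0 a cwp1).
  refine (etrans _ (cellD K1_ge0 K2_ge0 (contM (@cont_cst R a) cwp1) cwp2)).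
  by apply: eq_Rintegral => p _; ring.
exists 0%N, (\int[leb2]_(p in cell K1 K2) `|w p|) => psi M [sm _] bnd.
have cpsi : continuous psi by exact: (smooth_cont (s := [::]) sm).
have cnorm (f : R * R -> R) : continuous f -> continuous (fun p => `|f p|).
  by move=> cf p; apply: cvg_norm; exact: cf.
rewrite distr_real /sqmod /= expr0n/= addr0 sqrtr_sqr.
apply: le_trans (le_normr_Rintegral (measurable_cell K1 K2)
  (continuous_integrable_cell K1_ge0 K2_ge0 (contM cw cpsi))) _.
rewrite mulrC -cellZ//; last exact: cnorm.
apply: le_Rintegral.
- exact: measurable_cell.
- by apply: continuous_integrable_cell => //; apply: cnorm; exact: contM.
- by apply: continuous_integrable_cell => //; apply: contM; [exact: cont_cst|exact: cnorm].
- by move=> p _; rewrite normrM mulrC ler_wpM2r//; exact: (bnd [::] p).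
Qed.

End test_functions.

(** * The mode in the domain of the operator *)

Section mode_in_domain.
Context {R : realType}.
Variables (K1 K2 kk lam c : R) (phi z z1 z2 z3 : R -> R).
Hypotheses (K1_gt0 : 0 < K1) (K2_gt0 : 0 < K2) (kkK2 : kk * K2 = 2 * pi).
Hypothesis phiT : forall x, phi (x + K1) = phi x.
Hypothesis cphi : continuous phi.
Hypothesis gm : growing_mode K1 kk lam (fun x => c - phi x) z z1 z2 z3.
Implicit Types (psi : R * R -> R) (x y : R).
Local Open Scope complex_scope.
Local Notation leb := (@lebesgue_measure R).
Local Notation leb2 := (leb \x leb)%E.
Local Notation cell := (cell K1 K2).

Let K1_ge0 : 0 <= K1. Proof. exact: ltW. Qed.
Let K2_ge0 : 0 <= K2. Proof. exact: ltW. Qed.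

Let cosy y : R := cos (kk * y).
Let siny y : R := sin (kk * y).

Definition mode_real (a : R) (p : R * R) : R := a * (z1 p.1 * cosy p.2).

Definition mode (a : R) (p : R * R) : R[i] := (mode_real a p)%:C.

Let dcos y : is_derive y 1 cosy (- (kk * siny y)).
Proof.
have := der_comp (is_derive_cos (kk * y)) (derM (der_cst kk y) (der_id y)).
by move=> D; apply: (is_derive_eq D); rewrite /siny; ring.
Qed.

Let dsin y : is_derive y 1 siny (kk * cosy y).
Proof.
have := der_comp (is_derive_sin (kk * y)) (derM (der_cst kk y) (der_id y)).
by move=> D; apply: (is_derive_eq D); rewrite /cosy; ring.
Qed.

Let cosyT y : cosy (y + K2) = cosy y.
Proof. by rewrite /cosy mulrDr kkK2 mulr_natl cosD2pi. Qed.

Let sinyT y : siny (y + K2) = siny y.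
Proof. by rewrite /siny mulrDr kkK2 mulr_natl sinD2pi. Qed.

Let dz := gm_z gm.
Let dz1 := gm_z1 gm.
Let dz2 := gm_z2 gm.
Let dM := gm_eq gm.
Let zT := gm_T gm.
Let z1T := der_periodic dz zT.
Let z2T := der_periodic dz1 z1T.
Let z3T := der_periodic dz2 z2T.
Let ccos : continuous cosy. Proof. exact: (der_continuous dcos). Qed.
Let cz : continuous z. Proof. exact: (der_continuous dz). Qed.
Let cz1 : continuous z1. Proof. exact: (der_continuous dz1). Qed.
Let cQ : continuous (fun x => c - phi x).
Proof. by move=> x; apply: cvgB; [exact: cvg_cst|exact: cphi]. Qed.

Lemma mode_real_continuous a : continuous (mode_real a).
Proof.
apply: contM; first exact: cont_cst.
by apply: contM; [exact: cont_fst|exact: cont_snd].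
Qed.

Lemma mode_biperiodic a : biperiodic K1 K2 (mode a).
Proof. by move=> x y; rewrite /mode /mode_real /= z1T cosyT. Qed.

Let slice_cont a y : continuous (fun x => mode_real a (x, y)).
Proof.
apply: (der_continuous (f' := fun x => a * (z2 x * cosy y))) => x.
have := derM (der_cst a x) (derM (dz1 x) (der_cst (cosy y) x)).
by move=> D; apply: (is_derive_eq D); ring.
Qed.

Lemma mode_real_mean0 a y : \int[leb]_(x in `[0, K1]) mode_real a (x, y) = 0.
Proof.
have D x : is_derive x 1 (fun x => a * (z x * cosy y)) (mode_real a (x, y)).
  have := derM (der_cst a x) (derM (dz x) (der_cst (cosy y) x)).
  by move=> D; apply: (is_derive_eq D); rewrite /mode_real/=; ring.
rewrite (FTC D _ K1_ge0); last exact: slice_cont.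
by have := zT 0; rewrite add0r => ->; rewrite subrr.
Qed.

Lemma integrable_mode_slice a y :
  leb.-integrable `[0, K1] (EFin \o (fun x => mode_real a (x, y))).
Proof. exact/integrable_itv/slice_cont. Qed.

Lemma mode_inX a : inX K1 K2 (mode a).
Proof.
have cm := @mode_real_continuous a.
split.
- exact: mode_biperiodic.
- split => /=; first exact: (continuous_measurable_plane cm).
  exact: measurable_cst.
- have cm2 : continuous (fun p => mode_real a p * mode_real a p) by exact: contM.
  have /integrableP[_] := continuous_integrable_cell K1_ge0 K2_ge0 cm2.
  apply: le_lt_trans; rewrite le_eqVlt; apply/orP; left; apply/eqP.
  apply: eq_integral => p _ /=; rewrite /sqmod /= expr0n addr0 ger0_norm//.
  by rewrite -expr2 sqr_ge0.
- apply: aeW => y; apply/eqP; rewrite eq_complex/= mode_real_mean0 eqxx/=.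
  by rewrite /Rintegral integral0.
Qed.

(** The mean-zero x-antiderivative of the second y-derivative of the mode. *)
Let q a p : R := - (kk ^+ 2) * (a * (z p.1 * cosy p.2)).

Let cq a : continuous (q a).
Proof.
apply: contM; first exact: cont_cst.
apply: contM; first exact: cont_cst.
by apply: contM; [exact: cont_fst|exact: cont_snd].
Qed.

Section test.
Variable psi : R * R -> R.
Hypothesis tpsi : test_function K1 K2 psi.
Let sm : smooth psi. Proof. by case: tpsi. Qed.
Let pT s := partials_biperiodic s tpsi.
Let cpsi s : continuous (partials s psi : R * R -> R).
Proof. exact: smooth_cont. Qed.
Let dx s x y := @smooth_dx R psi s x y sm.
Let dy s x y := @smooth_dy R psi s x y sm.

(** The difference of the two sides is the integral of a total x-derivative and
    of a total y-derivative. *)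
Lemma antiderivative_x a :
  \int[leb2]_(p in cell) (q a p * pdx psi p) =
  - \int[leb2]_(p in cell) (mode_real a p * pdy (pdy psi) p).
Proof.
have c1 : continuous (fun p => q a p * pdx psi p).
  by apply: contM => //; exact: (cpsi (s := [:: false])).
have c2 : continuous (fun p => mode_real a p * pdy (pdy psi) p).
  by apply: contM; [exact: mode_real_continuous|exact: (cpsi (s := [:: true; true]))].
have c3 : continuous (fun p => - (kk ^+ 2) * mode_real a p * psi p).
  apply: contM; last exact: (cpsi (s := [::])).
  by apply: contM; [exact: cont_cst|exact: mode_real_continuous].
have Ix : \int[leb2]_(p in cell)
    (q a p * pdx psi p + - (kk ^+ 2) * mode_real a p * psi p) = 0.
  apply: (cell_total_x K1_ge0 K2_ge0 (F := fun x y => q a (x, y) * psi (x, y))).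
  - exact: (contD c1 c3).
  - move=> x y; have := derM (derM (der_cst (- (kk ^+ 2)) x) (derM (der_cst a x)
      (derM (dz x) (der_cst (cosy y) x)))) (dx [::] x y).
    by move=> D; apply: (is_derive_eq D); rewrite /q /mode_real /=; ring.
  - by move=> x y; rewrite /q/= zT; case: (pT [::] x y) => /= ->.
have Iy : \int[leb2]_(p in cell) (mode_real a p * pdy (pdy psi) p
    + - (- (kk ^+ 2) * mode_real a p * psi p)) = 0.
  apply: (cell_total_y K1_ge0 K2_ge0
    (F := fun x y => a * z1 x * (cosy y * pdy psi (x, y) + kk * siny y * psi (x, y)))).
  - exact: (contD c2 (contN c3)).
  - move=> x y; have := derM (der_cst (a * z1 x) y) (derD (derM (dcos y) (dy [:: true] x y))
      (derM (derM (der_cst kk y) (dsin y)) (dy [::] x y))).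
    move=> D; apply: (is_derive_eq D); rewrite /mode_real /=.
    move: (pdy (pdy psi) _) (pdy psi _) (psi _) => p2 p1 p0.
    by ring.
  - move=> x y; rewrite cosyT sinyT.
    by have [_] := pT [:: true] x y; have [_] := pT [::] x y; rewrite /= => -> ->.
move: Ix Iy.
rewrite (cellD K1_ge0 K2_ge0 c1 c3) (cellD K1_ge0 K2_ge0 c2 (contN c3)).
rewrite (cellN K1_ge0 K2_ge0 c3) => Ix /subr0_eq ->.
by move/eqP: Ix; rewrite addr_eq0 => /eqP.
Qed.

(** By the equation of the mode, [z] is itself a total derivative, of
    (L z' - lam z) / kk^2. *)
Lemma antiderivative_mean0 a : (forall x y, psi (x, y) = psi (0, y)) ->
  \int[leb2]_(p in cell) (q a p * psi p) = 0.
Proof.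
move=> psi0.
pose M x := - z3 x + (c - phi x) * z1 x.
apply: (cell_total_x K1_ge0 K2_ge0
  (F := fun x y => - (a * cosy y * psi (0, y)) * (M x - lam * z x))).
- by apply: contM; [exact: cq|exact: (cpsi (s := [::]))].
- move=> x y; have := derM (der_cst (- (a * cosy y * psi (0, y))) x)
    (derD (dM x) (derN (derM (der_cst lam x) (dz x)))).
  by move=> D; apply: (is_derive_eq D); rewrite /q /= (psi0 x y); ring.
- by move=> x y; rewrite /M zT z1T z3T phiT.
Qed.

(** The difference of the two sides integrates the x-derivative of the
    bilinear concomitant of the mode and the test function. *)
Lemma mode_weak_equation a :
  \int[leb2]_(p in cell) (mode_real (lam * a) p * psi p) =
  \int[leb2]_(p in cell) (mode_real a p * pdx (pdx (pdx psi)) p)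
  - \int[leb2]_(p in cell) ((c - phi p.1) * mode_real a p * pdx psi p)
  + \int[leb2]_(p in cell) (q a p * psi p).
Proof.
have cm b := @mode_real_continuous b.
have c1 : continuous (fun p => mode_real (lam * a) p * psi p).
  by apply: contM => //; exact: (cpsi (s := [::])).
have c2 : continuous (fun p => mode_real a p * pdx (pdx (pdx psi)) p).
  by apply: contM => //; exact: (cpsi (s := [:: false; false; false])).
have c3 : continuous (fun p => (c - phi p.1) * mode_real a p * pdx psi p).
  apply: contM; last exact: (cpsi (s := [:: false])).
  by apply: contM; [exact: (cont_fst cQ)|exact: cm].
have c4 : continuous (fun p => q a p * psi p).
  by apply: contM; [exact: cq|exact: (cpsi (s := [::]))].
have c12 := contD c1 (contN c2); have c34 := contD c3 (contN c4).
have I : \int[leb2]_(p in cell) (mode_real (lam * a) p * psi p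
      + - (mode_real a p * pdx (pdx (pdx psi)) p)
    + ((c - phi p.1) * mode_real a p * pdx psi p + - (q a p * psi p))) = 0.
  apply: (cell_total_x K1_ge0 K2_ge0 (F := fun x y => a * cosy y *
    (- (z1 x * pdx (pdx psi) (x, y)) + z2 x * pdx psi (x, y)
     + (- z3 x + (c - phi x) * z1 x) * psi (x, y)))).
  - exact: (contD c12 c34).
  - move=> x y; have := derM (der_cst (a * cosy y) x) (derD (derD
      (derN (derM (dz1 x) (dx [:: false; false] x y)))
      (derM (dz2 x) (dx [:: false] x y)))
      (derM (dM x) (dx [::] x y))).
    move=> D; apply: (is_derive_eq D); rewrite /q /mode_real /=.
    move: (pdx (pdx (pdx psi)) _) (pdx (pdx psi) _) (pdx psi _) (psi _) => p3 p2 p1 p0.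
    by ring.
  - move=> x y; rewrite z1T z2T z3T phiT.
    have [h0 _] := pT [::] x y; have [h1 _] := pT [:: false] x y.
    have [h2 _] := pT [:: false; false] x y.
    by move: h0 h1 h2; rewrite /= => -> -> ->.
move: I.
rewrite (cellD K1_ge0 K2_ge0 c12 c34) (cellD K1_ge0 K2_ge0 c1 (contN c2)).
rewrite (cellD K1_ge0 K2_ge0 c3 (contN c4)).
rewrite (cellN K1_ge0 K2_ge0 c2) (cellN K1_ge0 K2_ge0 c4).
have solve (i1 i2 i3 i4 : R) : i1 - i2 + (i3 - i4) = 0 -> i1 = i2 - i3 + i4 by lra.
exact: solve.
Qed.

End test.

Lemma mode_linKP a : linKP K1 K2 c phi (mode a) (mode (lam * a)).
Proof.
split; [exact: mode_inX|exact: mode_inX|].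
exists (distr K1 K2 (fun p => (q a p)%:C)); first split.
- exact: distr_real_periodic_distribution.
- move=> psi tpsi; rewrite /dist_dx /dist_dy !opprK !distr_real.
  by rewrite (antiderivative_x tpsi) -rmorphN opprK.
- move=> psi tpsi psi0; rewrite distr_real (antiderivative_mean0 tpsi)//.
move=> psi tpsi; rewrite /dist_dx !opprK.
rewrite (_ : (fun p => (c - phi p.1)%:C * mode a p) =
    (fun p => ((c - phi p.1) * mode_real a p)%:C)); last first.
  by apply/funext => p; rewrite /mode -rmorphM.
by rewrite !distr_real (mode_weak_equation tpsi) rmorphD rmorphB opprD opprK.
Qed.

End mode_in_domain.

(** * The norm of the state space *)

Section nonintegrable.
Context d {T : measurableType d} {R : realType} (mu : {measure set T -> \bar R}).
Variable D : set T.
Hypothesis mD : measurable D.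
Implicit Types f g : T -> R.

(** [fine] maps both infinities to 0, and the positive or the negative part of a
    function that is not integrable has an infinite integral. *)
Lemma Rintegral_nonintegrable f : measurable_fun D f ->
  ~ mu.-integrable D (EFin \o f) -> \int[mu]_(x in D) f x = 0.
Proof.
move=> mf nint; rewrite /Rintegral integralE.
have mF : measurable_fun D (EFin \o f) by exact/measurable_EFinP.
have p0 : (0 <= \int[mu]_(x in D) (EFin \o f)^\+ x)%E by exact: integral_ge0.
have n0 : (0 <= \int[mu]_(x in D) (EFin \o f)^\- x)%E by exact: integral_ge0.
have I : (\int[mu]_(x in D) (EFin \o f)^\+ x + \int[mu]_(x in D) (EFin \o f)^\- x)%E = +oo%E.
  rewrite -ge0_integralD//; [|exact: measurable_funepos|exact: measurable_funeneg].
  apply/eqP; rewrite -leye_eq leNgt; apply/negP => lt.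
  apply: nint; apply/integrableP; split => //.
  apply: le_lt_trans lt; rewrite le_eqVlt; apply/orP; left; apply/eqP.
  by apply: eq_integral => x _; rewrite -[LHS]/((abse \o (EFin \o f)) x) fune_abse.
move: p0 n0 I.
case: (\int[mu]_(x in D) (EFin \o f)^\+ x)%E => [a| |] //;
  case: (\int[mu]_(x in D) (EFin \o f)^\- x)%E => [b| |] //.
Qed.

(** If [f] is not integrable, then neither is the sum, and both integrals are 0
    for this reason. *)
Lemma Rintegral_add0 f g : measurable_fun D f -> mu.-integrable D (EFin \o g) ->
  \int[mu]_(x in D) g x = 0 -> \int[mu]_(x in D) f x = 0 ->
  \int[mu]_(x in D) (g x + f x) = 0.
Proof.
move=> mf ig g0 f0.
have [jf|nif] := pselect (mu.-integrable D (EFin \o f)).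
  by rewrite RintegralD// g0 f0 addr0.
apply: Rintegral_nonintegrable => [|igf].
  apply: measurable_funD => //.
  by apply/measurable_EFinP; exact: measurable_int ig.
apply: nif; have := integrableB mD igf ig.
by apply: eq_integrable => // x _ /=; rewrite -EFinB addrAC subrr add0r.
Qed.

End nonintegrable.

Section norm.
Context {R : realType}.
Variables K1 K2 : R.
Implicit Types (v w : R * R -> R[i]) (a : R).
Local Open Scope complex_scope.
Local Notation leb := (@lebesgue_measure R).
Local Notation leb2 := (leb \x leb)%E.
Local Notation plane := (measurableTypeR R * measurableTypeR R)%type.
Local Notation cell := (cell K1 K2 : set plane).
Local Notation N := (normX K1 K2).

(** The part of [inX] that makes [normX] a norm. *)
Definition square_integrable v : Prop :=
  [/\ measurable_fun [set: plane] (fun p => complex.Re (v p) : measurableTypeR R),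
      measurable_fun [set: plane] (fun p => complex.Im (v p) : measurableTypeR R) &
      (\int[leb2]_(p in cell) (sqmod (v p))%:E < +oo)%E].

Lemma inX_square_integrable v : inX K1 K2 v -> square_integrable v.
Proof. by case=> _ [? ?] ? _. Qed.

Lemma sqmod_ge0 (z : R[i]) : 0 <= sqmod z.
Proof. by rewrite addr_ge0 ?sqr_ge0. Qed.

Lemma measurable_sqmod v : square_integrable v ->
  measurable_fun [set: plane] (fun p => sqmod (v p) : measurableTypeR R).
Proof. by case=> mr mi _; apply: measurable_funD; exact: measurable_funX. Qed.

Lemma integrable_sqmod v : square_integrable v ->
  leb2.-integrable cell (EFin \o (fun p => sqmod (v p))).
Proof.
move=> sv; apply/integrableP; split.
  by apply/measurable_EFinP; apply: measurable_funS (measurable_sqmod sv).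
case: sv => _ _; apply: le_lt_trans; rewrite le_eqVlt; apply/orP; left; apply/eqP.
by apply: eq_integral => p _ /=; rewrite ger0_norm// sqmod_ge0.
Qed.

Lemma square_integrable_lin a v w : square_integrable v -> square_integrable w ->
  square_integrable (fun p => a%:C * v p + w p).
Proof.
move=> sv sw; have [mrv miv _] := sv; have [mrw miw _] := sw.
have mr : measurable_fun [set: plane]
    (fun p => complex.Re (a%:C * v p + w p) : measurableTypeR R).
  rewrite (_ : (fun p => _) = (fun p => a * complex.Re (v p) + complex.Re (w p))).
    by apply: measurable_funD => //; exact: measurable_funM.
  by apply/funext => p; case: (v p) (w p) => [x y] [x' y'] /=; rewrite mul0r subr0.
have mi : measurable_fun [set: plane]
    (fun p => complex.Im (a%:C * v p + w p) : measurableTypeR R).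
  rewrite (_ : (fun p => _) = (fun p => a * complex.Im (v p) + complex.Im (w p))).
    by apply: measurable_funD => //; exact: measurable_funM.
  by apply/funext => p; case: (v p) (w p) => [x y] [x' y'] /=; rewrite mul0r addr0.
split => //.
have ivw : leb2.-integrable cell
    (EFin \o (fun p => 2 * a ^+ 2 * sqmod (v p) + 2 * sqmod (w p))).
  have mc := measurable_cell K1 K2.
  have := integrableD mc (integrableZl mc (2 * a ^+ 2) (integrable_sqmod sv))
    (integrableZl mc 2 (integrable_sqmod sw)).
  by apply: eq_integrable.
have /integrableP[mI] := ivw; apply: le_lt_trans.
apply: ge0_le_integral => //.
- exact: measurable_cell.
- by move=> p _; rewrite lee_fin sqmod_ge0.
- apply/measurable_EFinP; apply: measurable_funTS.
  by apply: measurable_funD; exact: measurable_funX.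
- exact: measurableT_comp.
- move=> p _; rewrite lee_fin ger0_norm; last first.
    by rewrite addr_ge0// mulr_ge0 ?sqmod_ge0// mulr_ge0 ?sqr_ge0.
  case: (v p) (w p) => [x y] [x' y']; rewrite /sqmod /= !mul0r subr0 addr0.
  have := sqr_ge0 (a * x - x'); have := sqr_ge0 (a * y - y'); nra.
Qed.

Lemma normX_ge0 v : 0 <= N v.
Proof. exact: sqrtr_ge0. Qed.

Lemma normX_sq v : N v ^+ 2 = \int[leb2]_(p in cell) sqmod (v p).
Proof.
rewrite sqr_sqrtr//; apply: Rintegral_ge0 => p _; exact: sqmod_ge0.
Qed.

Lemma normX_scale a v : square_integrable v -> N (fun p => a%:C * v p) = `|a| * N v.
Proof.
move=> sv; rewrite /normX -(sqrtr_sqr a) -sqrtrM ?sqr_ge0//; congr Num.sqrt.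
rewrite -RintegralZl; [|exact: measurable_cell|exact: integrable_sqmod].
apply: eq_Rintegral => p _; rewrite /sqmod; case: (v p) => x y /=.
by rewrite !mul0r subr0 addr0; ring.
Qed.

Lemma normX_ae v w : square_integrable v -> square_integrable w ->
  eqX v w -> N v = N w.
Proof.
move=> sv sw vw; rewrite /normX /Rintegral; congr (Num.sqrt (fine _)).
apply: ae_eq_integral.
- exact: measurable_cell.
- by apply/measurable_EFinP; apply: measurable_funTS; exact: measurable_sqmod.
- by apply/measurable_EFinP; apply: measurable_funTS; exact: measurable_sqmod.
- by apply: negligibleS vw => p /= h e; apply: h; rewrite e.
Qed.

(** Minkowski's inequality, from the pointwise bound
    |z + z'|^2 <= (1 + e) |z|^2 + (1 + 1/e) |z'|^2 with the best value of e,
    the quotient of the norms; the latter are enlarged to be positive. *)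
Lemma normX_triangle v w : square_integrable v -> square_integrable w ->
  N (fun p => v p + w p) <= N v + N w.
Proof.
move=> sv sw; apply/ler_addgt0Pr => d2 d20.
pose d := d2 / 2; have d0 : 0 < d by rewrite divr_gt0.
pose a := N v + d; pose b := N w + d.
have a0 : 0 < a by rewrite ltr_wpDl ?normX_ge0.
have b0 : 0 < b by rewrite ltr_wpDl ?normX_ge0.
rewrite [leRHS](_ : _ = a + b); last by rewrite /a /b /d; field.
rewrite -(@ler_pXn2r _ 2) ?nnegrE ?normX_ge0 ?(addr_ge0 (ltW a0) (ltW b0))//.
have e0 : 0 < b / a by rewrite divr_gt0.
apply: (@le_trans _ _ ((1 + b / a) * N v ^+ 2 + (1 + a / b) * N w ^+ 2)); last first.
  have va : N v ^+ 2 <= a ^+ 2.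
    by rewrite ler_pXn2r ?nnegrE ?normX_ge0 ?(ltW a0)// lerDl ltW.
  have wb : N w ^+ 2 <= b ^+ 2.
    by rewrite ler_pXn2r ?nnegrE ?normX_ge0 ?(ltW b0)// lerDl ltW.
  apply: (@le_trans _ _ ((1 + b / a) * a ^+ 2 + (1 + a / b) * b ^+ 2)).
    by apply: lerD; apply: ler_wpM2l => //; rewrite addr_ge0// divr_ge0 ?(ltW a0) ?(ltW b0).
  by rewrite le_eqVlt; apply/orP; left; apply/eqP; field; rewrite !gt_eqF.
have mc := measurable_cell K1 K2.
have svw : square_integrable (fun p => v p + w p).
  have := square_integrable_lin 1 sv sw.
  by rewrite (_ : (fun p => _) = (fun p => v p + w p))//; apply/funext => p; rewrite mul1r.
rewrite !normX_sq -!RintegralZl//; [|exact: integrable_sqmod|exact: integrable_sqmod].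
have iv := integrableZl mc (1 + b / a) (integrable_sqmod sv).
have iw := integrableZl mc (1 + a / b) (integrable_sqmod sw).
rewrite -RintegralD//.
apply: le_Rintegral => //; first exact: integrable_sqmod.
  by have := integrableD mc iv iw; apply: eq_integrable.
move=> p _; case: (v p) (w p) => [x y] [x' y']; rewrite /sqmod /=.
have h (s t : R) : (s + t) ^+ 2 <= (1 + b / a) * s ^+ 2 + (1 + a / b) * t ^+ 2.
  rewrite -subr_ge0 (_ : _ - _ = (b * s - a * t) ^+ 2 / (a * b)); last first.
    by field; rewrite !gt_eqF.
  by rewrite divr_ge0 ?sqr_ge0// mulr_ge0 ?(ltW a0) ?(ltW b0).
by have := h x x'; have := h y y'; lra.
Qed.

Lemma normX0 : N (fun=> 0) = 0.
Proof.
rewrite /normX (_ : \int[leb2]_(p in cell) _ = 0) ?sqrtr0//.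
rewrite /Rintegral integral0_eq// => p _.
by rewrite /sqmod /= expr0n addr0.
Qed.

End norm.

(** * Spectral instability and the orbit of the mode *)

Section instability.
Context {R : realType}.
Variables (K1 K2 kk lam c : R) (phi z z1 z2 z3 : R -> R).
Hypotheses (K1_gt0 : 0 < K1) (K2_gt0 : 0 < K2) (kkK2 : kk * K2 = 2 * pi).
Hypothesis phiT : forall x, phi (x + K1) = phi x.
Hypothesis cphi : continuous phi.
Hypothesis gm : growing_mode K1 kk lam (fun x => c - phi x) z z1 z2 z3.
Local Open Scope complex_scope.
Local Notation leb := (@lebesgue_measure R).
Local Notation leb2 := (leb \x leb)%E.
Local Notation plane := (measurableTypeR R * measurableTypeR R)%type.
Local Notation N := (normX K1 K2).
Local Notation X := (inX K1 K2).
Local Notation A := (linKP K1 K2 c phi).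
Local Notation mode := (mode kk z1).

Let modeX a : X (mode a). Proof. exact: (mode_inX K1_gt0 K2_gt0 kkK2 gm). Qed.
Let modeS a : square_integrable K1 K2 (mode a).
Proof. exact/inX_square_integrable/modeX. Qed.
Let modeA a : A (mode a) (mode (lam * a)).
Proof. exact: (mode_linKP K1_gt0 K2_gt0 kkK2 phiT cphi gm). Qed.
Let lam_gt0 : 0 < lam := gm_lam gm.

Lemma modeZ a b p : a%:C * mode b p = mode (a * b) p.
Proof. by rewrite /mode /mode_real -[a * b * _]mulrA [RHS]rmorphM. Qed.

Lemma modeD a b p : mode a p + mode b p = mode (a + b) p.
Proof. by rewrite /mode /mode_real mulrDl [RHS]rmorphD. Qed.

Lemma modeE a b : (fun p => a%:C * mode b p) = mode (a * b).
Proof. by apply/funext => p; exact: modeZ. Qed.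

Lemma modeB a b : (fun p => mode a p - mode b p) = mode (a - b).
Proof. by apply/funext => p; rewrite /mode /mode_real mulrBl [RHS]rmorphB. Qed.

Lemma normX_mode a : N (mode a) = `|a| * N (mode 1).
Proof. by rewrite -normX_scale// modeE mulr1. Qed.

Lemma normX_mode_gt0 : 0 < N (mode 1).
Proof.
rewrite /normX sqrtr_gt0.
pose co y : R := cos (kk * y).
have cco : continuous co.
  apply: (der_continuous (f' := fun y => - sin (kk * y) * kk)) => y.
  have := der_comp (is_derive_cos (kk * y)) (derM (der_cst kk y) (der_id y)).
  by move=> D; apply: (is_derive_eq D); rewrite mul0r add0r mulr1.
have cz1 : continuous z1 by exact: (der_continuous (gm_z1 gm)).
have csq (f : R -> R) : continuous f -> continuous (fun x => f x * f x).
  by move=> cf x; apply: cvgM; exact: cf.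
rewrite (_ : \int[leb2]_(p in cell K1 K2) _ =
    \int[leb]_(x in `[0, K1]) (z1 x * z1 x) * \int[leb]_(y in `[0, K2]) (co y * co y)).
  have z1T := der_periodic (gm_z gm) (gm_T gm).
  have coT y : co (y + K2) = co y.
    by rewrite /co mulrDr kkK2 mulr_natl cosD2pi.
  have [x0 zx0] := gm_neq0 gm.
  have I (f : R -> R) K : 0 < K -> \int[leb]_(x in `[0, K]) f x = prim f K.
    by move=> K0; rewrite /prim ltW.
  rewrite !I//; apply: mulr_gt0.
  - apply: (prim_gt0 (csq _ cz1) _ K1_gt0 (x0 := x0)) => [x|x|].
    + by rewrite z1T.
    + by rewrite -expr2 sqr_ge0.
    + by rewrite -expr2 lt_neqAle sqr_ge0 andbT eq_sym sqrf_eq0.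
  - apply: (prim_gt0 (csq _ cco) _ K2_gt0 (x0 := 0)) => [x|x|].
    + by rewrite coT.
    + by rewrite -expr2 sqr_ge0.
    + by rewrite /co mulr0 cos0 mulr1 ltr01.
rewrite -(cell_tensor (ltW K1_gt0) (ltW K2_gt0) (csq _ cz1) (csq _ cco)).
apply: eq_Rintegral => p _; rewrite /sqmod /mode /mode_real /= expr0n addr0.
by rewrite /co; ring.
Qed.

Lemma mode_spectrally_unstable : spectrally_unstable K1 K2 A.
Proof.
move=> stable; have : spectrum K1 K2 A lam%:C.
  move=> [_ [C HC]].
  have := HC (mode 1) (mode (lam * 1)) (modeA 1).
  rewrite (_ : (fun p => _) = (fun=> 0)).
    by rewrite normX0 mulr0 leNgt normX_mode_gt0.
  by apply/funext => p; have /(congr1 (@^~ p)) /= -> := modeE lam 1; rewrite subrr.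
by move=> /stable /=; rewrite leNgt lam_gt0.
Qed.

(** [X] is stable under adding a multiple of the mode. Where the zero mean of
    [u] over a line is only due to the convention for infinite integrals, so
    is that of the sum. *)
Lemma inX_add_mode a u : X u -> X (fun p => mode a p + u p).
Proof.
move=> Xu; have [per [mr mi] _ ae0] := Xu.
have su := inX_square_integrable Xu.
have [mr' mi' fin] : square_integrable K1 K2 (fun p => mode a p + u p).
  have := square_integrable_lin 1 (modeS a) su.
  by rewrite (_ : (fun p => _) = (fun p => mode a p + u p))//; apply/funext => p; rewrite mul1r.
split => //.
- move=> x y; have [-> ->] := mode_biperiodic kkK2 gm a x y.
  by have [-> ->] := per x y.
- apply: negligibleS ae0 => y /= h u0; apply: h.
  move/eqP: u0; rewrite eq_complex /= => /andP[/eqP re0 /eqP im0].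
  apply/eqP; rewrite eq_complex /=; apply/andP; split; apply/eqP.
  + rewrite -[RHS](Rintegral_add0 (mu := leb) (measurable_itv `[0, K1]) _
      (integrable_mode_slice gm a y) (mode_real_mean0 K1_gt0 gm a y) re0); last first.
      apply: measurable_funTS.
      apply: (measurableT_comp mr); exact: pair2_measurable.
    by apply: eq_Rintegral => x _; case: (u (x, y)).
  + rewrite -[RHS]im0; apply: eq_Rintegral => x _.
    by case: (u (x, y)) => ? ? /=; rewrite add0r.
Qed.

Section semigroup.
Variable S : R -> (R * R -> R[i]) -> R * R -> R[i].
Hypotheses (HS : C0_semigroup K1 K2 S) (genS : generates K1 K2 A S).
Variables M om : R.
Hypothesis growth : forall t u, 0 <= t -> X u -> N (S t u) <= M * expR (om * t) * N u.
Hypothesis om_lt : om < lam / 2.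

Let v := mode 1.
Let SX t u : 0 <= t -> X u -> X (S t u). Proof. by case: HS => + _ _ _ _; apply. Qed.

(** The generator only controls the semigroup to first order at time 0, where
    [dev] is o(t); that [dev] vanishes at all times has to be derived. *)
Let dev t p := mode (- expR (lam * t)) p + S t v p.
Let E t := N (dev t).

Let devX t : 0 <= t -> X (dev t).
Proof. by move=> t0; apply: inX_add_mode; apply: SX => //; exact: modeX. Qed.

Let M_ge0 : 0 <= M.
Proof.
have := growth (lexx 0) (modeX 1); rewrite mulr0 expR0 mulr1 => h.
by rewrite -(pmulr_lge0 _ normX_mode_gt0) (le_trans (normX_ge0 _ _ _) h).
Qed.

Let expR_om t : 0 <= t -> expR (om * t) <= expR (lam / 2 * t).
Proof. by move=> t0; rewrite ler_expR ler_wpM2r// ltW. Qed.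

Let E0 : E 0 = 0.
Proof.
have [_ _ S0 _ _] := HS.
rewrite /E (@normX_ae _ _ _ _ (mode (- 1 + 1))).
- by rewrite normX_mode addrC subrr normr0 mul0r.
- exact/inX_square_integrable/devX.
- exact: modeS.
- apply: negligibleS (S0 v (modeX 1)) => p /= h e; apply: h.
  by rewrite /dev e modeD mulr0 expR0.
Qed.

Let devE t : dev t = (fun p => (- expR (lam * t))%:C * v p + S t v p).
Proof. by apply/funext => p; rewrite modeZ mulr1. Qed.

Let devS t : 0 <= t -> square_integrable K1 K2 (dev t).
Proof. by move=> t0; exact/inX_square_integrable/devX. Qed.

Let sq_lin a u w : square_integrable K1 K2 u -> square_integrable K1 K2 w ->
  square_integrable K1 K2 (fun p => w p + a%:C * u p).
Proof.
move=> su sw; have := square_integrable_lin a su sw.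
by rewrite (_ : (fun p => a%:C * u p + w p) = (fun p => w p + a%:C * u p))//;
  apply/funext => p; rewrite addrC.
Qed.

Let sq_Z a u : square_integrable K1 K2 u -> square_integrable K1 K2 (fun p => a%:C * u p).
Proof.
move=> su; have := square_integrable_lin a su (modeS 0).
rewrite (_ : (fun p => _) = (fun p => a%:C * u p))//; apply/funext => p.
by rewrite /mode /mode_real mul0r addr0.
Qed.

(** Over a further time [h], the old deviation grows like the mode and a new one
    is transported by the semigroup. *)
Let E_step t h : 0 <= t -> 0 <= h ->
  E (t + h) <= M * expR (om * t) * E h + expR (lam * h) * E t.
Proof.
move=> t0 h0; have [_ [lin _] _ sg _] := HS.
have th0 : 0 <= t + h by exact: addr_ge0.
have Xh := SX h0 (modeX 1).
have e1 := sg t h v t0 h0 (modeX 1).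
have e2 := lin t (- expR (lam * h))%:C v (S h v) t0 (modeX 1) Xh.
have sSt : square_integrable K1 K2 (S t (dev h)).
  by apply/inX_square_integrable/SX => //; exact: devX.
have -> : E (t + h) = N (fun p => S t (dev h) p + (expR (lam * h))%:C * dev t p).
  apply: normX_ae; first exact: devS.
    by apply: sq_lin => //; exact: devS.
  apply: negligibleS (negligibleU e1 e2) => p /= ne.
  have [p1|] := pselect (S (t + h) v p = S t (S h v) p); last by left.
  right => p2; apply: ne; rewrite [in RHS](devE h) p2 /dev p1.
  have <- : (expR (lam * h))%:C * mode (- expR (lam * t)) p = mode (- expR (lam * (t + h))) p.
    by rewrite modeZ mulrN -expRD -mulrDr (addrC h).
  by rewrite rmorphN; ring.
apply: le_trans (normX_triangle sSt (sq_Z _ (devS t0))) _.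
apply: lerD; first exact: growth (devX h0).
by rewrite (normX_scale _ (devS t0)) gtr0_norm// expR_gt0.
Qed.

Let E_growth h n : 0 <= h ->
  E (n%:R * h) <= n%:R * M * expR (lam * (n%:R * h)) * E h.
Proof.
move=> h0; elim: n => [|n IH]; first by rewrite !mul0r E0.
have nh : 0 <= n%:R * h by rewrite mulr_ge0.
have Eh : 0 <= E h by exact: normX_ge0.
rewrite [in leLHS]mulrS mulrDl mul1r [in leLHS]addrC.
apply: le_trans (E_step nh h0) _.
have l1 : expR (om * (n%:R * h)) <= expR (lam * (n.+1%:R * h)).
  rewrite ler_expR (@le_trans _ _ (lam / 2 * (n%:R * h)))//.
    by rewrite ler_wpM2r// ltW.
  apply: ler_pM => //; first by rewrite divr_ge0// ltW.
    by rewrite ler_pdivrMr// ler_peMr ?ler1n// ltW.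
  by rewrite ler_wpM2r// ler_nat.
have l2 : expR (lam * h) * expR (lam * (n%:R * h)) = expR (lam * (n.+1%:R * h)).
  by rewrite -expRD mulrS; congr expR; ring.
have s1 : M * expR (om * (n%:R * h)) * E h <= M * expR (lam * (n.+1%:R * h)) * E h.
  by rewrite ler_wpM2r// ler_wpM2l.
have s2 : expR (lam * h) * E (n%:R * h) <= n%:R * M * expR (lam * (n.+1%:R * h)) * E h.
  rewrite -l2 (_ : _ * _ * (_ * _) * _ = expR (lam * h) *
     (n%:R * M * expR (lam * (n%:R * h)) * E h)); last by ring.
  by rewrite ler_wpM2l// expR_ge0.
move: s1 s2; set Y := expR (lam * (n.+1%:R * h)) => s1 s2.
by rewrite mulrS !mulrDl mul1r lerD.
Qed.

(** The difference quotient of the semigroup tends to the image of the mode, and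
    that of the exponential to the same limit. *)
Let E_small e : 0 < e -> exists2 d, 0 < d & forall h, 0 < h < d -> E h <= e * h.
Proof.
move=> e0; have [e20 Nv] : 0 < e / 2 /\ 0 < N v by rewrite divr_gt0// normX_mode_gt0.
have /cvgrPdist_lt /(_ _ e20) c1 := (genS (modeX 1) (modeX (lam * 1))).1 (modeA 1).
have c2 : \forall t \near (0 : R)^'+, `|0 - lam * (expR (lam * t) - 1) * N v| < e / 2.
  have cF : continuous (fun t => lam * (expR (lam * t) - 1) * N v).
    apply: der_continuous => t; apply: (derM (derM (der_cst lam t)
      (derD (der_comp (is_derive_expR (lam * t)) (derM (der_cst lam t) (der_id t)))
        (der_cst (- 1) t))) (der_cst (N v) t)).
  have /cvgrPdist_lt := cvg_at_right_filter (cF 0).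
  by rewrite mulr0 expR0 subrr mulr0 mul0r; apply.
have [d /= d0 H] := (nbhs_ballP _ _).1 (filterI c1 c2).
exists d => // h /andP[h0 hd].
have [] := H h _ h0.
  by rewrite /ball/= sub0r normrN gtr0_norm.
rewrite !sub0r !normrN ger0_norm ?normX_ge0// => g1.
pose b := lam - h^-1 * (expR (lam * h) - 1).
have [cc /andP[cc0 cch] ccE] := der_MVT (f := fun t => expR (lam * t))
  (fun t => der_comp (is_derive_expR (lam * t)) (derM (der_cst lam t) (der_id t))) (ltW h0).
have bE : b = - (lam * (expR (lam * cc) - 1)).
  move: ccE; rewrite mulr0 expR0 subr0 mul0r add0r mulr1 => ccE.
  by rewrite /b ccE; field; rewrite gt_eqF.
have cc1 : 1 <= expR (lam * cc) by rewrite -expR0 ler_expR mulr_ge0// ltW.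
have cc2 : expR (lam * cc) <= expR (lam * h) by rewrite ler_expR ler_wpM2l// ltW.
have eh1 : 0 <= expR (lam * h) - 1 by lra.
rewrite ger0_norm; last by rewrite !mulr_ge0 ?normX_ge0 ?(ltW lam_gt0).
move=> g2.
have nb : `|b| <= lam * (expR (lam * h) - 1).
  rewrite bE normrN ger0_norm ?mulr_ge0 ?(ltW lam_gt0) ?subr_ge0//.
  by rewrite ler_wpM2l ?(ltW lam_gt0)// lerD2r.
have gE : (fun p => (h^-1)%:C * (S h v p - v p) - mode (lam * 1) p) =
    (fun p => (h^-1)%:C * dev h p + mode (- b) p).
  apply/funext => p; rewrite /dev /v.
  have -> : mode (lam * 1) p = lam%:C * mode 1 p by rewrite modeZ.
  have -> : mode (- b) p = (- b)%:C * mode 1 p by rewrite modeZ mulr1.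
  have -> : mode (- expR (lam * h)) p = (- expR (lam * h))%:C * mode 1 p.
    by rewrite modeZ mulr1.
  have -> : (- b)%:C = (h^-1)%:C * ((expR (lam * h))%:C - 1) - lam%:C.
    by rewrite -(rmorph1 (real_complex R)) -rmorphB -rmorphM -rmorphB; congr (_%:C); rewrite /b opprB.
  by rewrite rmorphN; ring.
have hE : (fun p => (h^-1)%:C * dev h p) =
    (fun p => ((h^-1)%:C * dev h p + mode (- b) p) + mode b p).
  by apply/funext => p; rewrite -addrA modeD addNr /mode /mode_real mul0r addr0.
have sg : square_integrable K1 K2 (fun p => (h^-1)%:C * dev h p + mode (- b) p).
  by apply: square_integrable_lin => //; apply: devS; exact: ltW.
have := normX_triangle sg (modeS b).
rewrite -hE -gE (normX_scale _ (devS (ltW h0))) normX_mode.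
rewrite gtr0_norm ?invr_gt0// -/v -/(E h) => tri.
rewrite -ler_pdivrMr// mulrC (le_trans tri)//.
have bN : `|b| * N v <= lam * (expR (lam * h) - 1) * N v by rewrite ler_wpM2r// normX_ge0.
move: g1 g2 bN; set G := N _; set B := _ * N v; set B' := _ * N v => g1 g2 bN; lra.
Qed.

(** [n] steps of length [t / n] contribute [n] deviations of size o(1 / n). *)
Let E_zero t : 0 < t -> E t = 0.
Proof.
move=> t0; apply/eqP; rewrite eq_le normX_ge0 andbT; apply/ler_addgt0Pr => e e0.
rewrite add0r.
pose B := M * expR (lam * t) * t.
have B0 : 0 <= B by rewrite !mulr_ge0 ?expR_ge0// ltW.
have e'0 : 0 < e / (B + 1) by rewrite divr_gt0// ltr_wpDl.
have [d d0 H] := E_small e'0.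
pose n := (Num.truncn (t / d)).+1.
have n0 : 0 < n%:R :> R by rewrite ltr0n.
have tn : t / d < n%:R by rewrite truncnS_gt.
have h0 : 0 < t / n%:R by rewrite divr_gt0.
have hd : t / n%:R < d by rewrite ltr_pdivrMr// mulrC -ltr_pdivrMr.
have tE : n%:R * (t / n%:R) = t by field; rewrite gt_eqF.
have := E_growth n (ltW h0); rewrite tE => /le_trans; apply.
have /H Eh : 0 < t / n%:R < d by rewrite h0.
have c0 : 0 <= n%:R * M * expR (lam * t) by rewrite !mulr_ge0 ?expR_ge0// ltW.
apply: le_trans (ler_wpM2l c0 Eh) _.
have simpl_n (x : R) : x != 0 ->
    x * M * expR (lam * t) * (e / (B + 1) * (t / x)) = B / (B + 1) * e.
  move=> x0; have B1 : B + 1 != 0 by rewrite gt_eqF// ltr_wpDl.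
  by move: B1; rewrite /B => B1; field; rewrite B1 x0.
rewrite simpl_n ?gt_eqF//.
by rewrite ler_piMl ?(ltW e0)// ler_pdivrMr ?ltr_wpDl// mul1r lerDl.
Qed.

(** The orbit of the mode grows at rate [lam], against the bound with the rate
    [om]; at time [t] the ratio of the two exceeds the constant [M]. *)
Lemma semigroup_growth_contradiction : False.
Proof.
pose t := 2 * (M + 1) / lam.
have t0 : 0 < t by rewrite divr_gt0// mulr_gt0// ltr_wpDl.
have big : M < expR (lam / 2 * t).
  rewrite (_ : lam / 2 * t = M + 1); last by rewrite /t; field; rewrite gt_eqF.
  by have := expR_ge1Dx (M + 1); lra.
have tri := normX_triangle (devS (ltW t0)) (modeS (expR (lam * t))).
have Sv : N (S t v) <= M * expR (om * t) * N v := growth (ltW t0) (modeX 1).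
have sSt : square_integrable K1 K2 (S t v).
  by apply/inX_square_integrable/SX; [exact: ltW|exact: modeX].
have := normX_triangle (sq_Z (- 1) (devS (ltW t0))) sSt.
rewrite (_ : (fun p => (- 1)%:C * dev t p + S t v p) = mode (expR (lam * t))); last first.
  apply/funext => p; rewrite /dev.
  rewrite mulrDr modeZ mulN1r opprK rmorphN rmorph1 mulN1r.
  by rewrite addrNK.
rewrite (normX_scale _ (devS (ltW t0))) -/(E t) (E_zero t0) mulr0 add0r normX_mode.
rewrite gtr0_norm ?expR_gt0// => le1.
have le2 : expR (lam * t) * N v <= M * expR (lam / 2 * t) * N v.
  apply: le_trans le1 (le_trans Sv _).
  by rewrite ler_wpM2r ?normX_ge0// ler_wpM2l// expR_om// ltW.
move: le2; rewrite ler_pM2r ?normX_mode_gt0//.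
rewrite (_ : lam * t = lam / 2 * t + lam / 2 * t); last by field.
by rewrite expRD ler_pM2r ?expR_gt0// leNgt big.
Qed.

End semigroup.

End instability.

(** * Growing solutions and linear instability *)

Section linear_instability.
Context {R : realType}.
Variables (K1 K2 kk lam c : R) (phi z z1 z2 z3 : R -> R).
Hypotheses (K1_gt0 : 0 < K1) (K2_gt0 : 0 < K2) (kkK2 : kk * K2 = 2 * pi).
Hypothesis phiT : forall x, phi (x + K1) = phi x.
Hypothesis cphi : continuous phi.
Hypothesis gm : growing_mode K1 kk lam (fun x => c - phi x) z z1 z2 z3.
Local Open Scope complex_scope.
Local Notation leb := (@lebesgue_measure R).
Local Notation leb2 := (leb \x leb)%E.
Local Notation N := (normX K1 K2).
Local Notation X := (inX K1 K2).
Local Notation A := (linKP K1 K2 c phi).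
Local Notation mode := (mode kk z1).

Let lam_gt0 : 0 < lam := gm_lam gm.
Let modeX a : X (mode a). Proof. exact: (mode_inX K1_gt0 K2_gt0 kkK2 gm). Qed.
Let Nmode a : N (mode a) = `|a| * N (mode 1).
Proof. exact: (normX_mode K1_gt0 K2_gt0 kkK2 gm). Qed.
Let N1 : 0 < N (mode 1).
Proof. exact: (normX_mode_gt0 K1_gt0 K2_gt0 kkK2 gm). Qed.

Let dexp (t : R) : is_derive t 1 (fun t => expR (lam * t)) (lam * expR (lam * t)).
Proof.
have := der_comp (is_derive_expR (lam * t)) (derM (der_cst lam t) (der_id t)).
by move=> D; apply: (is_derive_eq D); ring.
Qed.

Lemma mode_mild_solution : mild_solution K1 K2 A (fun t => mode (expR (lam * t))).
Proof.
split => [t _|t t0|t t0]; first exact: modeX.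
- have -> : (fun s => N (fun p => mode (expR (lam * s)) p - mode (expR (lam * t)) p)) =
      (fun s => `|expR (lam * s) - expR (lam * t)| * N (mode 1)).
    by apply/funext => s; rewrite modeB Nmode.
  have : `|expR (lam * s) - expR (lam * t)| * N (mode 1) @[s --> t] -->
      `|expR (lam * t) - expR (lam * t)| * N (mode 1).
    apply: cvgM; last exact: cvg_cst.
    by apply: cvg_norm; apply: cvgB; [exact: (der_continuous dexp)|exact: cvg_cst].
  by rewrite subrr normr0 mul0r; exact: cvg_within_filter.
- exists (mode ((expR (lam * t) - 1) / lam)) => [psi [sm _]|].
    have cpsi : continuous psi by exact: (smooth_cont (s := [::]) sm).
    pose I := \int[leb2]_(p in cell K1 K2) (mode_real kk z1 1 p * psi p).
    have cI : continuous (fun p => mode_real kk z1 1 p * psi p).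
      by apply: contM => //; exact: (mode_real_continuous gm).
    have dI b : distr K1 K2 (mode b) psi = (b * I)%:C.
      rewrite distr_real -(cellZ (ltW K1_gt0) (ltW K2_gt0) b cI).
      by congr (_%:C); apply: eq_Rintegral => p _; rewrite /mode_real mul1r !mulrA.
    rewrite dI (_ : (fun s => _) = (fun s => (expR (lam * s) * I)%:C)); last first.
      by apply/funext => s; exact: dI.
    apply/eqP; rewrite eq_complex /=; apply/andP; split; apply/eqP.
    + have D (s : R) : is_derive s 1 (fun s => expR (lam * s) * (I / lam)) (expR (lam * s) * I).
        apply: (is_derive_eq (derM (dexp s) (der_cst (I / lam) s))).
        by field; rewrite gt_eqF.
      rewrite (FTC D _ t0); last first.
        by move=> s; apply: cvgM; [exact: (der_continuous dexp)|exact: cvg_cst].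
      by rewrite mulr0 expR0; field; rewrite gt_eqF.
    + by rewrite /Rintegral integral0.
  rewrite modeB mulr0 expR0.
  rewrite [X in linKP _ _ _ _ _ (mode X)](_ : _ = lam * ((expR (lam * t) - 1) / lam)).
    exact: (mode_linKP K1_gt0 K2_gt0 kkK2 phiT cphi gm).
  by field; rewrite gt_eqF.
Qed.

Lemma mode_linearly_unstable : linearly_unstable K1 K2 A.
Proof.
split=> [S HS genS gb|sub].
  have lam2 : (growth_bound K1 K2 S < (lam / 2)%:E)%E.
    by apply: le_lt_trans gb _; rewrite lte_fin divr_gt0.
  have [_ [om [M growth] <-]] := ereal_inf_lt lam2.
  rewrite lte_fin => om_lt.
  exact: (semigroup_growth_contradiction K1_gt0 K2_gt0 kkK2 phiT cphi gm HS genS growth om_lt).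
have lam20 : 0 < lam / 2 by rewrite divr_gt0.
have /cvgrPdist_lt /(_ _ N1)[B [_ HB]] := sub _ mode_mild_solution _ lam20.
pose t := `|B| + 1.
have Bt : B < t by rewrite (le_lt_trans (ler_norm B))// ltrDl.
have := HB t Bt; rewrite sub0r normrN Nmode (gtr0_norm (expR_gt0 _)).
rewrite mulrA -expRD ger0_norm ?mulr_ge0 ?expR_ge0 ?normX_ge0//.
rewrite gtr_pMl// -[X in _ < X]expR0 ltr_expR ltNge => /negP; apply.
rewrite (_ : _ + _ = lam / 2 * t); last by field.
by rewrite mulr_ge0 ?(ltW lam20)// addr_ge0.
Qed.

End linear_instability.


Theorem theorem1 (R : realType) (c phi0 phi1 xi : R)
    (h01 : phi0 < phi1) (hc : 3 * c < 2 * phi0 + phi1) :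
  let kappa := cnoidal_modulus c phi0 phi1 in
  let K1 := cnoidal_period c phi0 phi1 in
  let phi := cnoidal c phi0 phi1 xi in
  [/\ 0 < kappa ^+ 2 < 1,
      (forall K2 : R, 0 < K2 ->
         kp1_solution K1 K2 (fun t x y => phi (x - c * t)))
    & exists2 K2 : R, 0 < K2 &
        spectrally_unstable K1 K2 (linKP K1 K2 c phi) /\
        linearly_unstable K1 K2 (linKP K1 K2 c phi)].
Proof.
move=> kappa K1 phi.
have jt := cnoidal_jacobi_triple xi h01 hc.
set S := wave_sn c phi0 phi1 xi in jt.
set al := cnoidal_alpha c phi0 phi1 in jt.
have phiE : phi = (fun x => c - lame_coef al kappa S x).
  by apply/funext => x; exact: cnoidalE.
have QE : lame_coef al kappa S = (fun x => c - phi x).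
  by apply/funext => x; rewrite phiE opprB addrC subrK.
have phiT x : phi (x + K1) = phi x by rewrite phiE /lame_coef (jt_ST jt) sqrrN.
have [phi' [phi'' []]] := wave_derivatives jt c.
rewrite -phiE QE => d0 d1 d2.
have [kk [lam [z [z1 [z2 [z3]]]]]] := exists_growing_mode jt.
rewrite QE => gm.
have K1_gt0 := jt_T jt; have kk_gt0 := gm_kk gm.
have cphi := der_continuous d0.
have K2_gt0 : 0 < 2 * pi / kk by rewrite divr_gt0// mulr_gt0// pi_gt0.
have kkK2 : kk * (2 * pi / kk) = 2 * pi by rewrite mulrC divfK// gt_eqF.
split.
- exact: cnoidal_modulus_itv.
- by move=> K2 _; exact: kp1_traveling_solution d0 d1 d2.
- exists (2 * pi / kk) => //; split.
  + exact: (mode_spectrally_unstable K1_gt0 K2_gt0 kkK2 phiT cphi gm).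
  + exact: (mode_linearly_unstable K1_gt0 K2_gt0 kkK2 phiT cphi gm).
Qed.
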